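(* Let $n\ge1$. For $w\in S_{2n+1}$ define $\Theta_w:E(w)\to\mathcal{P}(n+1)$ by $\Theta_w(u)=u\cdot L_0$, where $L_0$ is the $(n+1)\times(n+1)$ zero matrix. Then: (i) $\Theta_w$ is injective if and only if $w$ is efficient; (ii) if $w\ne v$ are both efficient, then $\mathrm{image}(\Theta_w)\cap\mathrm{image}(\Theta_v)=\emptyset$; (iii) if $w$ is not efficient, there is a unique efficient $v\in S_{2n+1}$ such that $\mathrm{image}(\Theta_w)=\mathrm{image}(\Theta_v)$.
   Context: Efficient permutations: $w\in S_{2n+1}$ is efficient if (1) $w(1)<w(3)<\cdots<w(2n+1)$ and $w(2)<w(4)<\cdots<w(2n)$, and (2) $w(1)<w(2)$, $w(3)<w(4)$, ..., $w(2n-1)<w(2n)$. Products of permutations are compositions of functions (right factor applied first), and $s_i=(i\ i+1)$. The group: $\mathfrak{el}_{2n}$ is the real Lie algebra generated by $e_1,\dots,e_{2n}$ with relations $[e_i,e_j]=0$ for $|i-j|>1$ and $[e_i,[e_i,e_j]]=-2e_i$ for $|i-j|=1$. It is isomorphic to $\mathfrak{sp}_{2n}(\mathbb{R})$ (real $2n\times 2n$ block matrices $\begin{pmatrix} A&B\\ C&D\end{pmatrix}$ with $A=-D^T$, $B=B^T$, $C=C^T$) via $$e_{2i-1}\mapsto\begin{pmatrix}0&a_ia_i^T\\0&0\end{pmatrix},\qquad e_{2i}\mapsto\begin{pmatrix}0&0\\ b_ib_i^T&0\end{pmatrix}\qquad(1\le i\le n),$$ where $\varepsilon_1,\dots,\varepsilon_n$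 is the standard basis of $\mathbb{R}^n$, $a_1=\varepsilon_1$, $a_i=\varepsilon_{i-1}+\varepsilon_i$ for $2\le i\le n$, and $b_i=\varepsilon_i$. $EL_{2n}$ is the group $Sp_{2n}(\mathbb{R})$ with Lie algebra identified with $\mathfrak{el}_{2n}$ in this way, $u_i(a)=\exp(ae_i)$, and $(EL_{2n})_{\ge0}$ is the subsemigroup generated by all $u_i(a)$, $1\le i\le 2n$, $a\ge0$. For $w\in S_{2n+1}$ with reduced word $i_1\cdots i_\ell$ (so $w=s_{i_1}\cdots s_{i_\ell}$ with $\ell$ minimal), $E(w)=\{u_{i_1}(a_1)\cdots u_{i_\ell}(a_\ell): a_1,\dots,a_\ell>0\}$; this does not depend on the choice of reduced word. Networks: an electrical network $N$ is a finite undirected (multi)graph with positive real edge weights $w(e)$ (conductances), whose vertices are divided into boundary and interior vertices; every connected component is assumed to contain a boundary vertex. Its Kirchhoff matrix $K$ is indexed by all vertices: $K_{ij}=-\sum_{e\text{ joins }i,j}w(e)$ for $i\ne j$ and $K_{ii}=\sum_{e\text{ incident to }i}w(e)$ (loops ignored). The response matrix $L(N)$, indexed by boundary vertices, is the Schur complement $K/K_I$, where $K_I$ is the submatrix indexed by interior vertices. A planar electrical network with $n+1$ boundary vertices is one embedded in a disk, with boundary vertices numbered $1,\dots,n+1$ in circular order on the boundary of the disk and everything else inside. $\mathcal{P}(n+1)\subset\mathbb{R}^{(n+1)^2}$ is the set of response matrices of such networks. $L_0$ is the response matrix of the empty network (no edges, $n+1$ boundary vertices). Action: for $t> 0$, $v_{2k-1}(t)(N)$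 is obtained from $N$ by adding a new vertex $v$ and an edge of weight $1/t$ from $v$ to boundary vertex $k$, then declaring the old vertex $k$ interior and $v$ to be the new boundary vertex $k$; $v_{2k}(t)(N)$ is obtained by adding an edge of weight $t$ between boundary vertices $k$ and $k+1$; $v_i(0)(N)=N$. The semigroup $(EL_{2n})_{\ge0}$ acts (well-definedly, on the left) on $\mathcal{P}(n+1)$ by $u_i(a)\cdot L(N)=L(v_i(a)(N))$. *)

(* Defs.v *)
From HB Require Import structures.
From mathcomp Require Import all_boot all_order all_algebra all_fingroup.
From mathcomp Require Import all_classical all_reals all_analysis.

Set Implicit Arguments.
Unset Strict Implicit.
Unset Printing Implicit Defensive.

Import Order.TTheory GRing.Theory Num.Theory.
Import numFieldNormedType.Exports.

Local Open Scope classical_set_scope.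
Local Open Scope ring_scope.

(* All indices are shifted to start at 0: the index i : 'I_(n.*2) stands for
   i + 1 in 1..2n, the boundary vertex k : 'I_n.+1 for k + 1 in 1..n+1, and
   'S_(n.*2.+1) is S_{2n+1} acting on 0..2n.  In particular odd indices
   1, 3, 5, ... of the usual notation are the even ones here, and both
   2k-1 and 2k become indices i with i./2 equal to k - 1. *)

Section Permutations.
Variable n : nat.

Definition efficient (w : 'S_(n.*2.+1)) : Prop :=
  (forall i j : 'I_(n.*2.+1), j = i.+2 :> nat -> (w i < w j)%N) /\
  (forall i j : 'I_(n.*2.+1), ~~ odd i -> j = i.+1 :> nat -> (w i < w j)%N).

Definition simple_refl (i : 'I_(n.*2)) : 'S_(n.*2.+1) :=
  tperm (inord i) (inord i.+1).

(* The product of permutations in MathComp applies its left factor first, so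
   the composite of functions s_{i_1} o ... o s_{i_l} is built by putting the
   first letter on the right. *)
Definition word_perm (x : seq 'I_(n.*2)) : 'S_(n.*2.+1) :=
  foldr (fun i w => (w * simple_refl i)%g) 1%g x.

Definition reduced_word (w : 'S_(n.*2.+1)) (x : seq 'I_(n.*2)) : Prop :=
  word_perm x = w /\
  forall y : seq 'I_(n.*2), word_perm y = w -> (size x <= size y)%N.

End Permutations.

Section Group.
Variables (R : realType) (n : nat).

Definition expmx (m : nat) (A : 'M[R]_m) : 'M[R]_m :=
  limn (series (fun k => (k`!%:R)^-1 *: A ^+ k)).

(* [veca k] is eps_k + eps_(k-1); the second term is absent when k = 0. *)
Definition veca (k : nat) : 'cV[R]_n :=
  \col_(j < n) ((j == k :> nat)%:R + (j.+1 == k :> nat)%:R).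

Definition vecb (k : nat) : 'cV[R]_n := \col_(j < n) (j == k :> nat)%:R.

Definition gen_e (i : 'I_(n.*2)) : 'M[R]_(n + n) :=
  if odd i then block_mx 0 0 (vecb i./2 *m (vecb i./2)^T) 0
  else block_mx 0 (veca i./2 *m (veca i./2)^T) 0 0.

Definition gen_u (i : 'I_(n.*2)) (a : R) : 'M[R]_(n + n) := expmx (a *: gen_e i).

Definition cellE (w : 'S_(n.*2.+1)) : set 'M[R]_(n + n) :=
  [set g | exists x : seq ('I_(n.*2) * R),
     [/\ reduced_word w (unzip1 x),
         forall p, p \in x -> 0 < p.2
       & g = \prod_(p <- x) gen_u p.1 p.2]].

End Group.

(* Edges are undirected: the order of the two components of [ends e] is
   irrelevant to [adjacent], [kirchhoff] and [planar]. *)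
Record network (R : realType) (n : nat) := Network {
  vert : finType;
  edge : finType;
  ends : edge -> vert * vert;
  weight : edge -> R;
  bdry : 'I_n.+1 -> vert }.

Section Networks.
Variables (R : realType) (n : nat).
Implicit Type N : network R n.

Definition joins N (e : edge N) (x y : vert N) : bool :=
  (ends e == (x, y)) || (ends e == (y, x)).

Definition adjacent N : rel (vert N) := fun x y => [exists e : edge N, joins e x y].

Definition electrical N : Prop :=
  [/\ injective (@bdry _ _ N),
      forall e : edge N, 0 < weight e
    & forall x : vert N, exists k, connect (@adjacent N) x (bdry N k)].

Definition interior_vert N : {set vert N} := [set x | x \notin codom (@bdry _ _ N)].

Definition kirchhoff N (x y : vert N) : R :=
  if x == y then \sum_(e : edge N | [exists z, (z != x) && joins e x z]) weight e
  else - \sum_(e : edge N | joins e x y) weight e.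

(* Schur complement of the interior block in the Kirchhoff matrix. *)
Definition response N : 'M[R]_n.+1 :=
  let int (i : 'I_#|interior_vert N|) := enum_val i in
  let KBB := \matrix_(i, j) kirchhoff (bdry N i) (bdry N j) in
  let KBI := \matrix_(i, j) kirchhoff (bdry N i) (int j) in
  let KIB := \matrix_(i, j) kirchhoff (int i) (bdry N j) in
  let KII := \matrix_(i, j) kirchhoff (int i) (int j) in
  KBB - KBI *m invmx KII *m KIB.

Definition open_disk : set (R * R) := [set z | z.1 ^+ 2 + z.2 ^+ 2 < 1].

(* Embedding in the closed unit disk: vertex positions [pos], one arc per edge
   parametrised by [0, 1] and simple on ]0, 1[ (a loop has equal endpoints), and
   angles [theta] placing the boundary vertices on the circle in cyclic order;
   nothing else meets the circle. *)
Definition planar N : Prop :=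
  exists (pos : vert N -> R * R) (arc : edge N -> R -> R * R)
         (theta : 'I_n.+1 -> R),
  [/\ [/\ forall j k : 'I_n.+1, (j < k)%N -> theta j < theta k,
          theta ord_max < theta ord0 + 2 * pi
        & forall k, pos (bdry N k) = (cos (theta k), sin (theta k))],
      injective pos /\ (forall x, x \in interior_vert N -> open_disk (pos x)),
      forall e, [/\ {within `[0, 1], continuous (arc e)},
                    arc e 0 = pos (ends e).1 & arc e 1 = pos (ends e).2],
      forall e (t : R), 0 < t < 1 ->
        open_disk (arc e t) /\ (forall x, arc e t <> pos x)
    & forall e f (s t : R), 0 < s < 1 -> 0 < t < 1 ->
        arc e s = arc f t -> e = f /\ s = t].

Definition planar_responses : set 'M[R]_n.+1 :=
  [set L | exists N, [/\ electrical N, planar N & L = response N]].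

Definition add_spike (k : 'I_n.+1) (c : R) N : network R n :=
  @Network R n (option (vert N)) (option (edge N))
    (fun e => if e is Some e' then (Some (ends e').1, Some (ends e').2)
              else (None, Some (bdry N k)))
    (fun e => if e is Some e' then weight e' else c)
    (fun j => if j == k then None else Some (bdry N j)).

Definition add_edge (k l : 'I_n.+1) (c : R) N : network R n :=
  @Network R n (vert N) (option (edge N))
    (fun e => if e is Some e' then ends e' else (bdry N k, bdry N l))
    (fun e => if e is Some e' then weight e' else c)
    (@bdry _ _ N).

Definition op_v (i : 'I_(n.*2)) (t : R) N : network R n :=
  if t == 0 then N
  else if odd i then add_edge (inord i./2) (inord i./2.+1) t N
  else add_spike (inord i./2) t^-1 N.

(* [acts g L L'] : the element g of the semigroup generated by the u_i(a), a >= 0,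
   takes the response matrix L to L'.  This is the relation generated by
   u_i(a) . L(N) = L(v_i(a)(N)) for N planar and (g h) . L = g . (h . L). *)
Inductive acts : 'M[R]_(n + n) -> 'M[R]_n.+1 -> 'M[R]_n.+1 -> Prop :=
| acts_gen (i : 'I_(n.*2)) (a : R) N :
    0 <= a -> electrical N -> planar N ->
    acts (gen_u i a) (response N) (response (op_v i a N))
| acts_mul (g h : 'M[R]_(n + n)) (L L' L'' : 'M[R]_n.+1) :
    acts h L L' -> acts g L' L'' -> acts (g *m h) L L''.

(* [acts g] is a function on [planar_responses] for g in the semigroup, so the
   value selected here is its unique value; it is arbitrary elsewhere. *)
Definition act (g : 'M[R]_(n + n)) (L : 'M[R]_n.+1) : 'M[R]_n.+1 :=
  xget 0 [set L' | acts g L L'].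

(* The maps Theta_w are the restrictions of [Theta] to the sets [cellE w]. *)
Definition Theta (g : 'M[R]_(n + n)) : 'M[R]_n.+1 := act g 0.

End Networks.
Arguments planar_responses : clear implicits.
Arguments cellE R {n} w.

(* Main.v *)
From HB Require Import structures.
Require Import Defs.
From mathcomp Require Import all_boot all_order all_algebra all_fingroup.
From mathcomp Require Import all_classical all_reals all_analysis.
From mathcomp Require Import ring lra zify.

Set Implicit Arguments.
Unset Strict Implicit.
Unset Printing Implicit Defensive.

Import Order.TTheory GRing.Theory Num.Theory.
Import numFieldNormedType.Exports.

Local Open Scope classical_set_scope.
Local Open Scope ring_scope.

(** The idea is to replace response matrices by subspaces of R^2n, on which the
    group acts linearly, and to read efficient permutations off these subspaces.

    Every response matrix reached from L_0 has the form D M D^T for a fixed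
    signed incidence matrix D and an n x n matrix M.  Adding an edge adds t b b^T
    to M and adding a spike replaces M by M (1 + t a a^T M)^-1, which is exactly
    how u_i(t) = 1 + t e_i moves the graph of M, the column span of (1; M)
    ([op_v_graph], [acts_graph]).  So Theta g is the same thing as the subspace
    g V_0, where V_0 is the graph of 0, and equality of two values of Theta is the
    relation [same_span] ([Theta_same]).  That the action can be carried out on
    planar networks is shown by drawing: a dent is pushed into the disk near the
    place where the new edge goes, and the edge is drawn in the space gained
    ([drawable_add_spike], [drawable_add_edge]).

    An efficient permutation w of 1, ..., 2n+1 is a lattice path: reading the values in
    increasing order, step up if the value sits at an odd position and down
    otherwise.  The identity is the zigzag 0, 1, 0, 1, ...; left
    multiplication by s_i that keeps w efficient and lengthens it turns the valley
    of the path at the vertex i into a peak.  [Cell] collects the products of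
    generators that follow such a growth of the path.  Four facts carry the
    argument.

    - A complete flag sees the path: the dimensions of g V_0 cut by the flag of
      coordinates y_1, x_1, y_2, x_2, ... are given by the path of the cell of g,
      because u_i(t) preserves every step of the flag but one ([pivot_valley],
      [Cell_pivot]).  Hence cells of different paths have disjoint images and each
      cell maps injectively ([Cell_disjoint], [Cell_inj]).

    - Where the path has no valley at i, the factor u_i changes nothing: the
      images of u_i(R_>0) Cell and Cell agree ([bump_push], [bump_pull]).  On a
      peak this is u_i(a) u_i(b) = u_i(a + b).  On a slope the braid relation
      moves the factor u_i down through the cell, one column at a time, until
      it reaches V_0, where it is absorbed by a series reduction.

    - Thus the image of E(w) depends only on a path computed from a reduced word
      of w by the min-plus rule h(i) := min(h(i-1), h(i+1)) + 1.  The result does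
      not depend on the word because it has the closed form
      h(j) = min_k (|[j] xor w[k]| + (k mod 2)) ([height], [heightM]).
      Every such path is the path of an efficient permutation.

    - At the first letter, read from the right, of a reduced word that leaves
      the efficient permutations, the factor u_i is not on a valley, and pushing it down yields
      two different group elements with the same image ([bump_noninj],
      [cellE_noninj]).

    In the lemmas all indices start at 0, so the index i of a generator belongs to
    the vertex i + 1 of the path, and odd positions are the even numbers. *)

(** * The one-parameter subgroups u_i *)

Section Generators.
Variables (R : realType) (n : nat).
Local Notation M2 := 'M[R]_(n + n).
Implicit Types (i k : nat) (a b c : R) (g : M2).

(** The matrix e_i, with the index a plain number so that neighbouring indices can be
    formed freely. *)
Definition egen i : M2 :=
  if odd i then block_mx 0 0 (vecb R n i./2 *m (vecb R n i./2)^T) 0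
  else block_mx 0 (veca R n i./2 *m (veca R n i./2)^T) 0 0.

Definition ugen i a : M2 := 1%:M + a *: egen i.

Lemma egen_sq i : egen i *m egen i = 0.
Proof.
rewrite /egen; case: ifP => _; rewrite mulmx_block !mulmx0 !mul0mx !addr0;
  by rewrite -[RHS]block_mx0.
Qed.

(** e_i squares to zero, so the exponential series stops after its linear term. *)
Lemma gen_uE (i : 'I_(n.*2)) a : gen_u i a = ugen i a.
Proof.
rewrite /gen_u /expmx /ugen -[gen_e R i]/(egen i).
have E2 k : (a *: egen i) ^+ k.+2 = 0 :> M2.
  rewrite exprS exprS mulrA (_ : _ * (a *: egen i) = 0) ?mul0r // -mulmxE.
  by rewrite -scalemxAl -scalemxAr egen_sq !scaler0.
apply: (@cvg_lim M2); first exact: norm_hausdorff.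
apply: cvg_near_cst; exists 2%N => // m /=.
case: m => // -[//|m] _; rewrite /series /=.
rewrite big_nat_recl // big_nat_recl // big1 => [|k _].
  by rewrite expr0 expr1 fact0 factS fact0 !invr1 !scale1r addr0.
by rewrite E2 scaler0.
Qed.

Lemma ugen0 i : ugen i 0 = 1%:M.
Proof. by rewrite /ugen scale0r addr0. Qed.

Lemma ugenD i a b : ugen i a *m ugen i b = ugen i (a + b).
Proof.
rewrite /ugen mulmxDl !mulmxDr !mul1mx !mulmx1 -scalemxAl -scalemxAr egen_sq !scaler0 addr0.
by rewrite scalerDl addrA addrAC.
Qed.

Lemma ugenK i a : ugen i (- a) *m ugen i a = 1%:M.
Proof. by rewrite ugenD addNr ugen0. Qed.

Lemma ugen_unit i a : ugen i a \in unitmx.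
Proof. by case/mulmx1_unit: (ugenK i a). Qed.

Lemma veca_vecb (k l : nat) : (l < n)%N ->
  (veca R n k)^T *m vecb R n l = ((l == k)%:R + (l.+1 == k)%:R)%:M.
Proof.
move=> ln; apply/matrixP => p q; rewrite !ord1 !mxE (bigD1 (Ordinal ln)) //=.
rewrite big1 ?addr0 => [|j jl]; first by rewrite !mxE /= eqxx mulr1.
by rewrite !mxE -[_ == l :> nat]/(j == Ordinal ln) (negPf jl) mulr0.
Qed.

Lemma vecb_veca (k l : nat) : (l < n)%N ->
  (vecb R n l)^T *m veca R n k = ((l == k)%:R + (l.+1 == k)%:R)%:M.
Proof.
by move=> ln; rewrite -[LHS]trmxK trmx_mul trmxK veca_vecb // tr_scalar_mx.
Qed.

(** The products e_i e_k come down to the numbers a_p^T b_q, which are 1 for neighbouring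
    indices and 0 otherwise. *)
Lemma egen_mul (i k : nat) : (i < n.*2)%N -> (k < n.*2)%N ->
  egen i *m egen k =
    if odd i == odd k then 0
    else ((k == i.+1)%:R + (i == k.+1)%:R) *:
      (if odd i then block_mx 0 0 0 (vecb R n i./2 *m (veca R n k./2)^T)
       else block_mx (veca R n i./2 *m (vecb R n k./2)^T) 0 0 0).
Proof.
move=> i2 k2; rewrite /egen.
case oi: (odd i); case ok: (odd k) => /=; rewrite mulmx_block !mulmx0 !mul0mx ?addr0 ?add0r.
- by rewrite -[RHS]block_mx0.
- rewrite mulmxA -[X in X *m _]mulmxA vecb_veca; last lia.
  rewrite mul_mx_scalar -scalemxAl scale_block_mx !scaler0.
  by congr (block_mx _ _ _ (_ *: _)); rewrite addrC; congr (_%:R + _%:R); lia.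
- rewrite mulmxA -[X in X *m _]mulmxA veca_vecb; last lia.
  rewrite mul_mx_scalar -scalemxAl scale_block_mx !scaler0.
  by congr (block_mx (_ *: _) _ _ _); congr (_%:R + _%:R); lia.
- by rewrite -[RHS]block_mx0.
Qed.

Definition far (i k : nat) : bool := (i.+1 < k)%N || (k.+1 < i)%N.
Definition adj (i k : nat) : bool := (k == i.+1) || (i == k.+1).

Lemma egen_far i k : (i < n.*2)%N -> (k < n.*2)%N -> far i k -> egen i *m egen k = 0.
Proof.
move=> i2 k2 fik; rewrite egen_mul //; case: ifP => // _.
have -> : (k == i.+1) = false by move: fik; rewrite /far; lia.
have -> : (i == k.+1) = false by move: fik; rewrite /far; lia.
by rewrite addr0 scale0r.
Qed.

(** Together with e_i^2 = 0, this is the relation [e_i, [e_i, e_k]] = -2 e_i. *)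
Lemma egen_adj i k : (i < n.*2)%N -> (k < n.*2)%N -> adj i k ->
  egen i *m egen k *m egen i = egen i.
Proof.
move=> i2 k2 aik; rewrite egen_mul //.
have -> : (odd i == odd k) = false by move: aik; rewrite /adj; lia.
have -> : (k == i.+1)%:R + (i == k.+1)%:R = 1 :> R.
  have -> : (k == i.+1) = ~~ (i == k.+1) by move: aik; rewrite /adj; lia.
  by rewrite -natrD; case: (i == k.+1).
rewrite scale1r /egen; case: ifP => oi; rewrite mulmx_block !mulmx0 !mul0mx ?addr0 ?add0r.
  rewrite mulmxA -[X in X *m _]mulmxA veca_vecb; last lia.
  rewrite mul_mx_scalar -scalemxAl.
  have -> : (i./2 == k./2) = ~~ (i./2.+1 == k./2) by move: aik; rewrite /adj; lia.
  by rewrite -natrD; case: (_ == k./2); rewrite scale1r.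
rewrite mulmxA -[X in X *m _]mulmxA vecb_veca; last by move: aik; rewrite /adj; lia.
rewrite mul_mx_scalar -scalemxAl.
have -> : (k./2 == i./2) = ~~ (k./2.+1 == i./2) by move: aik; rewrite /adj; lia.
by rewrite -natrD; case: (_ == i./2); rewrite scale1r.
Qed.

Lemma farC i k : far i k = far k i.
Proof. by rewrite /far orbC. Qed.

Lemma adjC i k : adj i k = adj k i.
Proof. by rewrite /adj orbC. Qed.

Lemma ugen_far i k a b : (i < n.*2)%N -> (k < n.*2)%N -> far i k ->
  ugen i a *m ugen k b = ugen k b *m ugen i a.
Proof.
move=> i2 k2 fik; rewrite /ugen !(mulmxDl, mulmxDr) !mul1mx !mulmx1 -!scalemxAl -!scalemxAr.
by rewrite egen_far // egen_far 1?farC // !scaler0 !addr0 addrAC.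
Qed.

Lemma ugen_mul3 i k a b c : (i < n.*2)%N -> (k < n.*2)%N -> adj i k ->
  ugen i a *m ugen k b *m ugen i c =
  1%:M + (a + c + a * b * c) *: egen i + b *: egen k
    + (a * b) *: (egen i *m egen k) + (b * c) *: (egen k *m egen i).
Proof.
move=> i2 k2 aik.
have E : ugen i a *m ugen k b =
  1%:M + a *: egen i + b *: egen k + (a * b) *: (egen i *m egen k).
  by rewrite /ugen mulmxDl !mulmxDr !mul1mx !mulmx1 -!scalemxAl -scalemxAr !scalerA
    addrA [1%:M + _ + _]addrAC.
rewrite E {1}/ugen mulmxDr mulmx1 -scalemxAr !mulmxDl mul1mx -!scalemxAl egen_sq.
rewrite egen_adj // !scalerDr !scalerA scaler0 addr0.
set e := egen i; set f := egen k; set ef := e *m f; set fe := f *m e.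
by apply/matrixP => p q; rewrite !mxE; ring.
Qed.

(** The electrical form of Yang-Baxter: both sides expand in the span of 1, e_i, e_k, e_i e_k
    and e_k e_i, where the coefficients can be compared. *)
Lemma ugen_braid i k a b c : (i < n.*2)%N -> (k < n.*2)%N -> adj i k ->
  a + c + a * b * c != 0 ->
  ugen i a *m ugen k b *m ugen i c =
  ugen k (b * c / (a + c + a * b * c)) *m ugen i (a + c + a * b * c)
    *m ugen k (a * b / (a + c + a * b * c)).
Proof.
move=> i2 k2 aik nz; rewrite ugen_mul3 // ugen_mul3 1?adjC //.
set d := a + c + _ in nz *.
have -> : b * c / d + a * b / d + b * c / d * d * (a * b / d) = b by rewrite /d in nz *; field.
have -> : b * c / d * d = b * c by field.
have -> : d * (a * b / d) = a * b by field.
by apply/matrixP => p q; rewrite !mxE; ring.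
Qed.

End Generators.

(** * The base subspace and the coordinate flag *)

Section Flag.
Variables (R : realType) (n : nat).
Local Notation M2 := 'M[R]_(n + n).
Implicit Types (i k m : nat) (a b c t : R) (g : M2) (X : 'M[R]_(n + n, n)).
Local Notation ugen := (@ugen R n).
Local Notation egen := (@egen R n).

(** Its column span is the graph of the zero matrix, that is, the subspace that represents
    the empty network. *)
Definition base_mx : 'M[R]_(n + n, n) := col_mx 1%:M 0.

(** The subspaces g V_0 and g' V_0 coincide. *)
Definition same_span g g' : Prop :=
  exists2 P : 'M[R]_n, P \in unitmx & g' *m base_mx = g *m base_mx *m P.

Lemma same_span_refl g : same_span g g.
Proof. by exists 1%:M; rewrite ?unitmx1 ?mulmx1. Qed.

Lemma same_span_sym g g' : same_span g g' -> same_span g' g.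
Proof. by case=> P uP e; exists (invmx P); rewrite ?unitmx_inv // e mulmxK. Qed.

Lemma same_span_trans g2 g1 g3 : same_span g1 g2 -> same_span g2 g3 -> same_span g1 g3.
Proof.
case=> P uP eP [Q uQ eQ]; exists (P *m Q); first by rewrite unitmx_mul uP.
by rewrite eQ eP !mulmxA.
Qed.

Lemma same_span_mull h g g' : same_span g g' -> same_span (h *m g) (h *m g').
Proof. by case=> P uP e; exists P; rewrite // -!mulmxA e -mulmxA. Qed.

Lemma egen_base i : ~~ odd i -> egen i *m base_mx = 0.
Proof.
move=> /negPf oi; rewrite /egen oi /base_mx mul_block_col !mul0mx !mulmx0 !addr0.
by rewrite -[RHS]col_mx0.
Qed.

(** A spike on an isolated boundary vertex is invisible. *)
Lemma same_span_even i a : ~~ odd i -> same_span (ugen i a) 1%:M.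
Proof.
move=> oi; exists 1%:M; first exact: unitmx1.
by rewrite mulmx1 /ugen mulmxDl -scalemxAl egen_base // scaler0 addr0.
Qed.

(** Two conductors in series: resistances a and 1 / b add up.  The element
    1 + ab e_i e_k absorbs the difference, since e_i e_k maps V_0 to itself. *)
Lemma same_span_series i k a b : (i < n.*2)%N -> (k < n.*2)%N -> adj i k -> ~~ odd i ->
  1 + a * b != 0 -> same_span (ugen i a *m ugen k b) (ugen k (b / (1 + a * b))).
Proof.
move=> i2 k2 aik oi nz; apply: same_span_sym.
have ok : odd k by move: aik oi; rewrite /adj; lia.
pose A := veca R n i./2 *m (vecb R n k./2)^T.
have AA : A *m A = A.
  rewrite /A mulmxA -[X in X *m _]mulmxA vecb_veca; last lia.
  have -> : (k./2 == i./2) = ~~ (k./2.+1 == i./2) by move: aik oi; rewrite /adj; lia.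
  by rewrite -natrD mul_mx_scalar; case: (_ == i./2); rewrite scale1r.
have EFV : egen i *m egen k *m base_mx = base_mx *m A.
  rewrite egen_mul // (negPf oi) ok /=.
  have -> : (k == i.+1) = ~~ (i == k.+1) by move: aik; rewrite /adj; lia.
  rewrite -natrD (_ : (_ + (i == k.+1))%N = 1%N) ?scale1r; last by case: eqP.
  by rewrite /base_mx mul_block_col mul_col_mx !mul0mx ?mulmx0 !addr0 mulmx1 mul1mx.
have PK : (1%:M + (a * b) *: A) *m (1%:M - (a * b / (1 + a * b)) *: A) = 1%:M.
  rewrite mulmxBr mulmx1 mulmxDl mul1mx -scalemxAl -scalemxAr AA.
  by apply/matrixP => p q; rewrite !mxE; field.
exists (1%:M + (a * b) *: A); first by case/mulmx1_unit: PK.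
rewrite [in RHS]mulmxDr mulmx1 -scalemxAr.
have FEFV : egen k *m (base_mx *m A) = egen k *m base_mx.
  by rewrite -EFV !mulmxA egen_adj // adjC.
have ugenV l x (Y : 'M[R]_(n + n, n)) : ugen l x *m Y = Y + x *: (egen l *m Y).
  by rewrite /ugen mulmxDl mul1mx -scalemxAl.
rewrite -(mulmxA (ugen k _) base_mx A) -mulmxA !ugenV FEFV mulmxDr (egen_base oi) add0r.
rewrite -scalemxAr mulmxA EFV.
set x := egen k *m base_mx; set y := base_mx *m A.
by apply/matrixP => p q; rewrite !mxE; field.
Qed.

Lemma egen_neq0 i : (i < n.*2)%N -> egen i != 0.
Proof.
move=> i2; have ln : (i./2 < n)%N by lia.
pose j := Ordinal ln; apply/eqP; rewrite /egen; case: ifP => _ /matrixP E.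
  have := E (rshift n j) (lshift n j).
  rewrite block_mxEdl !mxE (bigD1 ord0) //= big1 ?addr0; last by move=> k; rewrite ord1.
  by rewrite !mxE /= eqxx mulr1 => /eqP; rewrite oner_eq0.
have := E (lshift n j) (rshift n j).
rewrite block_mxEur !mxE (bigD1 ord0) //= big1 ?addr0; last by move=> k; rewrite ord1.
rewrite !mxE /= eqxx (_ : (_.+1 == _) = false); last lia.
by rewrite addr0 mulr1 => /eqP; rewrite oner_eq0.
Qed.

Lemma egen_adj_free i k a b : (i < n.*2)%N -> (k < n.*2)%N -> adj i k ->
  a *: egen i = b *: egen k -> a = 0.
Proof.
move=> i2 k2 aik e; apply/eqP; have := egen_neq0 i2.
have : a *: egen i = 0.
  rewrite -(@egen_adj R n i k) // scalemxAl scalemxAl e -!scalemxAl egen_sq.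
  by rewrite mul0mx scaler0.
by move/eqP; rewrite scaler_eq0 => /orP[] // /eqP->; rewrite eqxx.
Qed.

(** The two sides of a series reduction give the same subspace, but they are different group
    elements, since e_i is not proportional to e_k. *)
Lemma ugen_series_neq i k a b c : (i < n.*2)%N -> (k < n.*2)%N -> adj i k ->
  a != 0 -> ugen i a *m ugen k b <> ugen k c.
Proof.
move=> i2 k2 aik az e; move/eqP: az; apply.
have : ugen i a = ugen k (c - b).
  by rewrite -[ugen i a]mulmx1 -(ugen0 R n k) -(addrN b) -[ugen k (b - b)]ugenD mulmxA e ugenD.
by rewrite /ugen => /addrI; apply: egen_adj_free.
Qed.

(** The coordinate forms in the order y_1, x_1, y_2, x_2, ... *)
Definition zrow m : 'rV[R]_(n + n) :=
  if odd m then row_mx (vecb R n m./2)^T 0 else row_mx 0 (vecb R n m./2)^T.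

Lemma veca_split i : (i < n.*2)%N ->
  (veca R n i./2)^T = (vecb R n i./2)^T + (1 < i)%N%:R *: (vecb R n i.-2./2)^T.
Proof.
move=> i2; apply/matrixP => p q; rewrite !mxE; congr (_ + _).
rewrite -natrM; congr (_%:R); have := ltn_ord q; lia.
Qed.

(** Among the forms, u_i(t) moves only the one just before the form number i out of the
    span of its predecessors; for even i it also changes the one just after, but within
    the span of the earlier forms. *)
Lemma zrow_egen i m : (i < n.*2)%N -> (m < n.*2)%N ->
  zrow m *m egen i = ((m.+1 == i) || ~~ odd i && (m == i.+1))%:R *:
    (zrow i + (~~ odd i && (1 < i)%N)%:R *: zrow i.-2).
Proof.
move=> i2 m2; rewrite /zrow /egen.
have -> : odd i.-2 = odd i && (i != 1)%N by lia.
case oi: (odd i) => /=; case om: (odd m); rewrite mul_row_block ?mulmx0 ?mul0mx ?addr0 ?add0r.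
- by rewrite (_ : (_ == _) = false); [rewrite scale0r row_mx0 | lia].
- rewrite orbF scale0r addr0 mulmxA -[(vecb R n m./2)^T *m _]trmxK trmx_mul trmxK.
  have -> : (vecb R n i./2)^T *m vecb R n m./2 = (m.+1 == i)%:R%:M.
    apply/matrixP => p q; rewrite !ord1 !mxE.
    have ln : (m./2 < n)%N by lia.
    rewrite (bigD1 (Ordinal ln)) //= big1 ?addr0 => [|j jl].
      by rewrite !mxE /= eqxx mulr1; congr (_%:R); lia.
    by rewrite !mxE -[_ == m./2 :> nat]/(j == Ordinal ln) (negPf jl) mulr0.
  by rewrite tr_scalar_mx mul_scalar_mx scale_row_mx scaler0.
- rewrite mulmxA vecb_veca; last lia.
  rewrite mul_scalar_mx !scale_row_mx !scaler0 add_row_mx addr0.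
  rewrite scale_row_mx scaler0 veca_split //; congr (row_mx _ (_ *: _)).
  rewrite -natrD; congr (_%:R); lia.
- rewrite (_ : (_ || _) = false); last lia.
  by rewrite scale0r row_mx0.
Qed.

(** For X of full column rank, the part of the column space of X on which the first m
    coordinates vanish has the complementary dimension. *)
Fixpoint flag m X : 'M[R]_n :=
  if m is m'.+1 then (flag m' X + zrow m' *m X)%MS else 0.

Definition pivot m X : bool := ~~ (zrow m *m X <= flag m X)%MS.

Lemma zrow_flag k m X : (k < m)%N -> (zrow k *m X <= flag m X)%MS.
Proof.
elim: m => // m IH; rewrite ltnS leq_eqVlt => /orP[/eqP->|/IH] /=.
  exact: addsmxSr.
by move=> s; apply: submx_trans s (addsmxSl _ _).
Qed.

Lemma flag_sub m X (Y : 'M[R]_n) :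
  (forall k, (k < m)%N -> (zrow k *m X <= Y)%MS) -> (flag m X <= Y)%MS.
Proof.
elim: m => [|m IH] H /=; first exact: sub0mx.
by rewrite addsmx_sub H // IH // => k km; apply: H; rewrite ltnW.
Qed.

Lemma pivotE m X : pivot m X = ~~ (flag m.+1 X <= flag m X)%MS.
Proof. by rewrite /= addsmx_sub submx_refl. Qed.

Lemma flag_ugen_sub i t m X : (i < n.*2)%N -> (m <= n.*2)%N -> m != i ->
  (flag m (ugen i t *m X) <= flag m X)%MS.
Proof.
move=> i2 m2 mi; apply: flag_sub => k km.
rewrite mulmxA /ugen mulmxDr mulmx1 mulmxDl addmx_sub ?zrow_flag //.
rewrite -scalemxAr zrow_egen //; last exact: leq_trans km m2.
case: (boolP (_ || _)) => [|_]; last by rewrite scale0r scaler0 mul0mx sub0mx.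
move=> H; have im : (i < m)%N by move: H mi km; lia.
rewrite -!scalemxAl !scalemx_sub // mulmxDl addmx_sub ?zrow_flag //.
case: (1 < i)%N / idP => i1.
  by rewrite -scalemxAl scalemx_sub // zrow_flag //; lia.
by rewrite andbF scale0r mul0mx sub0mx.
Qed.

(** Invertibility of u_i(t) turns the inclusion for t and for -t into an equality. *)
Lemma flag_ugen i t m X : (i < n.*2)%N -> (m <= n.*2)%N -> m != i ->
  (flag m (ugen i t *m X) :=: flag m X)%MS.
Proof.
move=> i2 m2 mi; apply/eqmxP; rewrite flag_ugen_sub //=.
have {1}-> : X = ugen i (- t) *m (ugen i t *m X) by rewrite mulmxA ugenK mul1mx.
exact: flag_ugen_sub.
Qed.

Lemma pivot_ugen i t m X : (i < n.*2)%N -> (m < n.*2)%N -> m != i -> m.+1 != i ->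
  pivot m (ugen i t *m X) = pivot m X.
Proof.
move=> i2 m2 mi m1i; rewrite !pivotE.
have e1 := @flag_ugen i t m.+1 X i2 m2 m1i; have e2 := @flag_ugen i t m X i2 (ltnW m2) mi.
by rewrite e1 e2.
Qed.

(** The two pivots swap: a nonzero multiple of the row i + 1, which is new, is added to
    the row i, which was not. *)
Lemma pivot_valley i t X : (i.+1 < n.*2)%N -> t != 0 ->
  ~~ pivot i X -> pivot i.+1 X ->
  pivot i (ugen i.+1 t *m X) /\ ~~ pivot i.+1 (ugen i.+1 t *m X).
Proof.
move=> i2 tz; rewrite /pivot negbK => pi pi1.
set w := (~~ odd i.+1 && (1 < i.+1)%N)%:R *: zrow i.-1 *m X.
have sw : (w <= flag i X)%MS.
  rewrite /w; case: (boolP (_ && _)) => [/andP[_ i1]|_].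
    by rewrite -scalemxAl scalemx_sub // zrow_flag //; lia.
  by rewrite scale0r mul0mx sub0mx.
have E : zrow i *m (ugen i.+1 t *m X) = zrow i *m X + t *: (zrow i.+1 *m X + w).
  rewrite mulmxA /ugen mulmxDr mulmx1 mulmxDl -scalemxAr zrow_egen //; last exact: ltnW.
  by rewrite eqxx scale1r -scalemxAl mulmxDl.
have i1i : i != i.+1 by lia.
have fe := flag_ugen t X i2 (ltnW (ltnW i2)) i1i.
have Z : zrow i.+1 *m X = t^-1 *: (zrow i *m (ugen i.+1 t *m X) - zrow i *m X) - w.
  by rewrite E [_ + t *: _]addrC addrK scalerA mulVf // scale1r addrK.
split.
  rewrite fe; apply/negP => s; move/negP: pi1; apply; rewrite Z.
  apply: submx_trans (addsmxSl _ _).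
  by rewrite addmx_sub ?eqmx_opp // scalemx_sub // addmx_sub // eqmx_opp.
have -> : zrow i.+1 *m (ugen i.+1 t *m X) = zrow i.+1 *m X.
  rewrite mulmxA /ugen mulmxDr mulmx1 mulmxDl -scalemxAr zrow_egen //.
  by rewrite (_ : (_ || _) = false); [rewrite scale0r scaler0 mul0mx addr0 | lia].
rewrite negbK Z /=.
have s2 : (flag i X <= flag i (ugen i.+1 t *m X) + zrow i *m (ugen i.+1 t *m X))%MS.
  by apply: submx_trans (addsmxSl _ _); rewrite fe.
rewrite addmx_sub ?eqmx_opp ?(submx_trans sw) // scalemx_sub // addmx_sub ?addsmxSr //.
by rewrite eqmx_opp (submx_trans pi).
Qed.

Lemma flag_mulr m X (P : 'M[R]_n) : (flag m (X *m P) :=: flag m X *m P)%MS.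
Proof.
elim: m => [|m IH] /=; first by rewrite mul0mx.
by rewrite mulmxA; apply: eqmx_trans (eqmx_sym (addsmxMr _ _ _)); apply: adds_eqmx.
Qed.

Lemma pivot_mulr m X (P : 'M[R]_n) : P \in unitmx -> pivot m (X *m P) = pivot m X.
Proof.
by move=> uP; rewrite /pivot flag_mulr mulmxA submxMfree // row_free_unit.
Qed.

Lemma zrow_base m : zrow m *m base_mx = if odd m then (vecb R n m./2)^T else 0.
Proof.
by rewrite /zrow /base_mx; case: odd; rewrite mul_row_col ?mulmx0 ?mul0mx ?mulmx1 ?addr0 ?add0r.
Qed.

Lemma pivot_base m : (m < n.*2)%N -> pivot m base_mx = odd m.
Proof.
move=> m2; rewrite /pivot zrow_base; case: ifP => om; last by rewrite sub0mx.
have ln : (m./2 < n)%N by lia.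
have F k : (k <= m)%N -> flag k base_mx *m vecb R n m./2 = 0.
  elim: k => [|k IH] km /=; first by rewrite mul0mx.
  apply/eqP; rewrite -submx0 addsmxMr addsmx_sub submx0 (IH (ltnW km)) eqxx /=.
  rewrite submx0 zrow_base; case: ifP => ok; last by rewrite mul0mx.
  apply/eqP/matrixP => p q; rewrite !mxE big1 // => j _; rewrite !mxE -natrM.
  by rewrite (_ : (_ * _)%N = 0%N) //; lia.
apply/negP => /submxP[D e].
have : (vecb R n m./2)^T *m vecb R n m./2 = 0 by rewrite e -mulmxA F ?mulmx0.
move/matrixP/(_ ord0 ord0); rewrite !mxE (bigD1 (Ordinal ln)) //= big1 ?addr0.
  by rewrite !mxE /= eqxx mulr1 => /eqP; rewrite oner_eq0.
by move=> j jl; rewrite !mxE -[_ == m./2 :> nat]/(j == Ordinal ln) (negPf jl) mulr0.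
Qed.

End Flag.

(** * Lattice paths *)

Section Heights.
Implicit Types (i j k : nat) (h : nat -> nat).

Definition height0 j : nat := odd j.

(** A valley becomes a peak; on a path with steps +1 and -1 every other local shape is left
    as it is.  The index i acts on the vertex i + 1 because indices start at 0. *)
Definition bump i h j : nat := if j == i.+1 then (minn (h i) (h i.+2)).+1 else h j.

Definition unbump i h j : nat := if j == i.+1 then (h j - 2)%N else h j.

Definition valley i h : bool := (h i == (h i.+1).+1) && (h i.+2 == (h i.+1).+1).

Definition peak i h : bool :=
  [&& h i.+1 == (h i).+1, h i.+1 == (h i.+2).+1 & (1 < h i.+1)%N].

(** The path is monotone at the vertex of i and rises towards the neighbour k; the third
    vertex i.*2.+1 - k is the one on the other side.  Treating both directions at once
    halves the arguments below. *)
Definition slope i k h : bool :=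
  [&& adj i k, h k.+1 == (h i.+1).+1 & h i.+1 == (h (i.*2.+1 - k)%N).+1].

Lemma bump_unbump i h : peak i h -> bump i (unbump i h) = h.
Proof.
move=> /and3P[/eqP p1 /eqP p2 p3]; apply/funext => j; rewrite /bump /unbump.
case: eqP => [->|//]; rewrite (_ : (i == i.+1) = false); last lia.
rewrite (_ : (i.+2 == i.+1) = false); lia.
Qed.

Lemma valley_unbump i h : peak i h -> valley i (unbump i h).
Proof.
move=> /and3P[/eqP p1 /eqP p2 p3]; rewrite /valley /unbump eqxx.
rewrite (_ : (i == i.+1) = false); last lia.
rewrite (_ : (i.+2 == i.+1) = false); lia.
Qed.

Lemma unbump_bump i h : valley i h -> unbump i (bump i h) = h.
Proof.
move=> /andP[/eqP p1 /eqP p2]; apply/funext => j; rewrite /bump /unbump.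
by case: eqP => [->|//]; lia.
Qed.

Lemma bumpE i h : bump i h i.+1 = (minn (h i) (h i.+2)).+1.
Proof. by rewrite /bump eqxx. Qed.

Lemma bumpN i h j : j != i.+1 -> bump i h j = h j.
Proof. by rewrite /bump => /negPf->. Qed.

Lemma unbumpE i h : unbump i h i.+1 = (h i.+1 - 2)%N.
Proof. by rewrite /unbump eqxx. Qed.

Lemma unbumpN i h j : j != i.+1 -> unbump i h j = h j.
Proof. by rewrite /unbump => /negPf->. Qed.

Lemma peak_bump i h : valley i h -> peak i (bump i h).
Proof.
by move=> /andP[/eqP p1 /eqP p2]; rewrite /peak bumpE !bumpN; lia.
Qed.

End Heights.

(** * Cells of group elements indexed by lattice paths *)

Section Cells.
Variables (R : realType) (n : nat).
Local Notation M2 := 'M[R]_(n + n).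
Implicit Types (i j k m : nat) (a b c t : R) (g : M2) (h : nat -> nat).
Local Notation ugen := (@ugen R n).
Local Notation egen := (@egen R n).

(** Group elements obtained while the path grows from the zigzag by filling valleys, with
    the number of steps as first index. *)
Inductive Cell : nat -> (nat -> nat) -> M2 -> Prop :=
| Cell0 : Cell 0 height0 1%:M
| CellS m i h g a : (i < n.*2)%N -> 0 < a -> valley i h -> Cell m h g ->
    Cell m.+1 (bump i h) (ugen i a *m g).

Lemma Cell_path m h g : Cell m h g ->
  [/\ h 0%N = 0%N,
      forall j, h j.+1 = (h j).+1 \/ h j = (h j.+1).+1,
      forall j, (n.*2 < j)%N -> h j = odd j
    & forall j, odd (h j) = odd j].
Proof.
elim=> [|{}m i {}h {}g a i2 _ /andP[/eqP v1 /eqP v2] _ [H0 H1 H2 H3]].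
  split=> [//|j|//|j]; rewrite /height0 /= ?oddb //.
  by case: odd; [right|left].
split=> [|j|j n2j|j].
- by rewrite bumpN.
- case: (j =P i) => [->|ji].
    by rewrite bumpE bumpN; lia.
  case: (j =P i.+1) => [->|ji1].
    by rewrite bumpE bumpN; lia.
  by rewrite !bumpN; [exact: H1|lia|lia].
- by rewrite bumpN; [exact: H2|lia].
- case: (j =P i.+1) => [->|ji]; last by rewrite bumpN; [exact: H3|lia].
  by have := H3 i.+1; rewrite bumpE; lia.
Qed.

Lemma Cell_unit m h g : Cell m h g -> g \in unitmx.
Proof.
by elim=> [|*]; rewrite ?unitmx1 // unitmx_mul ugen_unit.
Qed.

Lemma Cell_height0 m g : Cell m height0 g -> g = 1%:M.
Proof.
move E: height0 => h C; case: C E => // {}m i {}h {}g a i2 a0 v _ e.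
by have := peak_bump v; rewrite -e /peak /height0; lia.
Qed.

(** The last steps at two different peaks are at distance at least 2, hence commute, so any
    peak can be taken to be the last one that was made. *)
Lemma Cell_peak m h g i : (i < n.*2)%N -> Cell m h g -> peak i h ->
  exists m' a g', [/\ m = m'.+1, 0 < a, Cell m' (unbump i h) g' & g = ugen i a *m g'].
Proof.
move=> i2; elim=> [|{}m j {}h {}g a j2 a0 vj Cg IH] pi.
  by move: pi; rewrite /peak /height0; lia.
case: (i =P j) => [ij|ij].
  by exists m, a, g; rewrite ij unbump_bump.
have fij : far i j.
  move: vj pi => /andP[/eqP v1 /eqP v2] /and3P[].
  rewrite /far; case: (i =P j.+1) => [->|i1].
    by rewrite bumpE bumpN; lia.
  case: (j =P i.+1) => [j1|j1]; last lia.
  by rewrite -j1 bumpE bumpN; lia.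
have pi' : peak i h by move: pi; rewrite /peak !bumpN //; move: fij; rewrite /far; lia.
case: IH => // m' [b [g' [-> b0 Cg' ->]]].
exists m'.+1, b, (ugen j a *m g'); split=> //; last first.
  by rewrite !mulmxA ugen_far // farC.
have -> : unbump i (bump j h) = bump j (unbump i h).
  apply/funext => l; rewrite /bump.
  case: (l =P j.+1) => [->|lj].
    rewrite unbumpN; last by move: fij; rewrite /far; lia.
    by rewrite eqxx !unbumpN //; move: fij; rewrite /far; lia.
  by rewrite /unbump; case: eqP => // _; rewrite (negPf (introN eqP lj)).
apply: CellS => //.
by move: vj; rewrite /valley !unbumpN //; move: fij; rewrite /far; lia.
Qed.

(** Where the path is still as low as the zigzag allows, no generator near i has been used. *)
Lemma Cell_low m h g i : (i < n.*2)%N -> Cell m h g ->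
  (h i <= 1)%N -> (h i.+1 <= 1)%N -> (h i.+2 <= 1)%N -> egen i *m g = g *m egen i.
Proof.
move=> i2; elim=> [|{}m j {}h {}g a j2 a0 vj Cg IH] l1 l2 l3.
  by rewrite mulmx1 mul1mx.
have fij : far i j.
  have hb : (1 < bump j h j.+1)%N by case/and3P: (peak_bump vj).
  rewrite /far; case: (j.+1 =P i) => [e|]; first by move: hb; rewrite e ltnNge l1.
  case: (j =P i) => [e|]; first by move: hb; rewrite e in l2 *; rewrite ltnNge l2.
  case: (j =P i.+1) => [e|]; first by move: hb; rewrite {2}e ltnNge l3.
  lia.
have nb l : far i j -> (i <= l <= i.+2)%N -> l != j.+1 by rewrite /far; lia.
move: l1 l2 l3; rewrite !bumpN ?nb //; try lia.
move=> l1 l2 l3; rewrite -mulmxA -IH // !mulmxA; congr (_ *m _).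
rewrite /ugen mulmxDr mulmxDl mul1mx mulmx1 -scalemxAl -scalemxAr.
by rewrite (egen_far _ i2 j2 fij) (egen_far _ j2 i2) // farC.
Qed.

Lemma comm_ugen i a g : egen i *m g = g *m egen i -> ugen i a *m g = g *m ugen i a.
Proof.
by move=> e; rewrite /ugen mulmxDl mulmxDr mul1mx mulmx1 -scalemxAl -scalemxAr e.
Qed.

(** The last step either is far from i, or is the neighbour k.  In the latter case, removing
    it uncovers a peak at i; either that peak can be removed too, leaving a slope at k in
    the direction of travel, or the bottom of the path is reached. *)
Lemma slope_cases m h g i k : (i < n.*2)%N -> Cell m h g -> slope i k h ->
  exists m' j h' b g', [/\ m = m'.+1, h = bump j h', g = ugen j b *m g', Cell m' h' g'
    & [/\ (j < n.*2)%N, 0 < b, valley j h' & (far i j /\ slope i k h') \/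
    j = k /\
    ((exists m'' h'' c g'' k', [/\ m' = m''.+1, h' = bump i h'', g' = ugen i c *m g'',
       Cell m'' h'' g'' & [/\ 0 < c, valley i h'' & slope k k' h'']]) \/
     [/\ ~~ odd i, egen i *m g' = g' *m egen i & egen k *m g' = g' *m egen k])]].
Proof.
move=> i2; case=> [|{}m j {}h {}g b j2 b0 vj Cg] s.
  by move: s; rewrite /slope /height0; lia.
exists m, j, h, b, g; split=> //; split=> //.
have [H0 H1 _ Ho] := Cell_path Cg.
move: (vj) (s) => /andP[/eqP v1 /eqP v2] /and3P[aik].
case: (j =P k) => [jk|jk]; last first.
  have [e1|nf] := boolP (far i j).
    move=> _ _; left; split=> //; move: s e1 aik; rewrite /slope /far /adj => s e1 aik.
    have [n1 n2] : k.+1 != j.+1 /\ i.+1 != j.+1 by lia.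
    have n3 : (i.*2.+1 - k)%N != j.+1 by lia.
    by move: s; rewrite (bumpN _ n1) (bumpN _ n2) (bumpN _ n3).
  move: aik nf; rewrite /adj /far => /orP[]/eqP e nf; subst.
    have {nf} : j = i \/ i = j.+1 by lia.
    case=> e; subst.
      by rewrite bumpE !bumpN; lia.
    rewrite (_ : (j.+1.*2.+1 - j.+2)%N = j.+1); last lia.
    by rewrite bumpE !bumpN; lia.
  have {nf} : j = k.+1 \/ j = k.+2 by lia.
  case=> e; subst.
    by rewrite bumpE !bumpN; lia.
  rewrite (_ : (k.+1.*2.+1 - k)%N = k.+3); last lia.
  by rewrite bumpE !bumpN; lia.
subst j => /eqP s1 /eqP s2; right; split=> //.
have [E1 E2] : h i = (h i.+1).-1 /\ h i.+2 = (h i.+1).-1 /\ (0 < h i.+1)%N.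
  move: s1 s2; move: aik; rewrite /adj => /orP[]/eqP e; subst.
    rewrite (_ : (i.*2.+1 - i.+1)%N = i); last lia.
    by rewrite bumpE !bumpN; lia.
  rewrite (_ : (k.+1.*2.+1 - k)%N = k.+3); last lia.
  by rewrite bumpE !bumpN; lia.
case: E2 => E2 E3.
case: (ltnP 1 (h i.+1)) => hi; [left | right].
  have pi : peak i h by rewrite /peak; lia.
  have [m'' [c [g'' [-> c0 Cg'' ->]]]] := Cell_peak i2 Cg pi.
  exists m'', (unbump i h), c, g'', (if i < k then k.+1 else k.-1)%N.
  rewrite bump_unbump // valley_unbump //; split=> //; split=> //.
  move: aik v1 v2; rewrite /adj => /orP[]/eqP e; subst; rewrite ?ltnSn => v1 v2.
    rewrite /slope (_ : (i.+1.*2.+1 - i.+2)%N = i.+1); last lia.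
    by rewrite unbumpE !unbumpN /adj; lia.
  rewrite (_ : (k.+1 < k)%N = false); last lia.
  case: k => [|k] in i2 b0 s1 s2 vj j2 s hi pi E1 E2 E3 v1 v2 Cg Cg'' *.
    by move: v1; rewrite H0; lia.
  rewrite [k.+1.-1]/= /slope (_ : (k.+1.*2.+1 - k)%N = k.+3); last lia.
  by rewrite unbumpE !unbumpN /adj; lia.
split; first by have := Ho i.+1; lia.
  by apply: (Cell_low i2 Cg); lia.
by apply: (Cell_low j2 Cg); move: aik; rewrite /adj => /orP[]/eqP e; subst; lia.
Qed.

Lemma ugen_far_mull i j a b g : (i < n.*2)%N -> (j < n.*2)%N -> far i j ->
  ugen i a *m (ugen j b *m g) = ugen j b *m (ugen i a *m g).
Proof. by move=> i2 j2 f; rewrite !mulmxA ugen_far. Qed.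

Lemma slope_bound i k m h g : (i < n.*2)%N -> Cell m h g -> slope i k h -> (k < n.*2)%N.
Proof.
move=> i2 Cg; have [H0 H1 H2 _] := Cell_path Cg.
move=> /and3P[aik /eqP s1 /eqP s2]; rewrite ltnNge; apply/negP => nk.
by move: s1; rewrite H2; [lia|lia].
Qed.

(** The braid relation trades u_i u_k u_i for u_k u_i u_k, which moves the extra factor from
    the column of i to that of k while the cell loses two steps; at the bottom, the series
    reduction swallows the factor. *)
Lemma slope_push m h g i k a : (i < n.*2)%N -> 0 < a -> Cell m h g -> slope i k h ->
  exists2 g', Cell m h g' & same_span (ugen i a *m g) g'.
Proof.
elim/ltn_ind: m => m IH in h g i k a * => i2 a0 Cg s.
have k2 := slope_bound i2 Cg s; have aik : adj i k by case/and3P: s.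
have [m' [j [h' [b [g' [me he ge1 Cg' [j2 b0 vj alt]]]]]]] := slope_cases i2 Cg s.
subst m h g; case: alt => [[fij s']|[jk alt]].
  have [g1 Cg1 s1] := IH m' (ltnSn _) _ _ _ _ _ i2 a0 Cg' s'.
  exists (ugen j b *m g1); first exact: CellS.
  by rewrite ugen_far_mull //; apply: same_span_mull.
subst j; case: alt => [[m'' [h'' [c [g'' [k' [me he ge1 Cg'' [c0 vi s'']]]]]]]|[oi ci ck]].
  subst m' h' g'.
  have d0 : 0 < a + c + a * b * c by rewrite !addr_gt0 // !mulr_gt0.
  have d1 : 0 < a * b / (a + c + a * b * c) by rewrite !divr_gt0 // !mulr_gt0.
  have [g1 Cg1 s1] := IH m'' (leqnSn _) _ _ _ _ _ k2 d1 Cg'' s''.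
  exists (ugen k (b * c / (a + c + a * b * c)) *m (ugen i (a + c + a * b * c) *m g1)).
    by apply: CellS => //; [rewrite !divr_gt0 // !mulr_gt0|apply: CellS].
  rewrite !mulmxA ugen_braid ?gt_eqF // -!mulmxA.
  by do 2!apply: same_span_mull.
have ab0 : 0 < 1 + a * b by rewrite addr_gt0 // mulr_gt0.
exists (ugen k (b / (1 + a * b)) *m g').
  by apply: CellS => //; rewrite divr_gt0.
rewrite (comm_ugen b ck) mulmxA (comm_ugen a ci) -mulmxA (comm_ugen _ ck).
by apply/same_span_mull/same_span_series; rewrite ?gt_eqF.
Qed.

Lemma slope_pull m h g i k : (i < n.*2)%N -> Cell m h g -> slope i k h ->
  exists a g', [/\ 0 < a, Cell m h g' & same_span (ugen i a *m g') g].
Proof.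
elim/ltn_ind: m => m IH in h g i k * => i2 Cg s.
have k2 := slope_bound i2 Cg s; have aik : adj i k by case/and3P: s.
have [m' [j [h' [b [g' [me he ge1 Cg' [j2 b0 vj alt]]]]]]] := slope_cases i2 Cg s.
subst m h g; case: alt => [[fij s']|[jk alt]].
  have [a [g1 [a0 Cg1 s1]]] := IH m' (ltnSn _) _ _ _ _ i2 Cg' s'.
  exists a, (ugen j b *m g1); split; [exact: a0|exact: CellS|].
  by rewrite ugen_far_mull //; apply: same_span_mull.
subst j; case: alt => [[m'' [h'' [c [g'' [k' [me he ge1 Cg'' [c0 vi s'']]]]]]]|[oi ci ck]].
  subst m' h' g'.
  have [|a [g1 [a0 Cg1 s1]]] := IH m'' _ _ _ _ _ k2 Cg'' s''; first by lia.
  have d0 : 0 < b + a + b * c * a by rewrite !addr_gt0 // !mulr_gt0.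
  exists (c * a / (b + a + b * c * a)).
  exists (ugen k (b + a + b * c * a) *m (ugen i (b * c / (b + a + b * c * a)) *m g1)).
  split; first by rewrite !divr_gt0 // !mulr_gt0.
    by apply: CellS => //; apply: CellS => //; rewrite !divr_gt0 // !mulr_gt0.
  rewrite !mulmxA -ugen_braid ?gt_eqF // 1?adjC // -!mulmxA.
  by do 2!apply: same_span_mull.
(* chosen so that 2 b / (1 + (2 b)^-1 2 b) = b *)
exists (2 * b)^-1, (ugen k (2 * b) *m g').
have b2 : 0 < 2 * b by rewrite mulr_gt0.
split; [by rewrite invr_gt0|exact: CellS|].
rewrite (comm_ugen _ ck) mulmxA (comm_ugen _ ci) -mulmxA (comm_ugen b ck).
apply: same_span_mull; have {3}-> : b = 2 * b / (1 + (2 * b)^-1 * (2 * b)).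
  by field; rewrite gt_eqF.
by apply: same_span_series; rewrite // mulVf ?gt_eqF.
Qed.

(** Pushing down as in [slope_push] only changes the element at the very bottom, where
    the series reduction fails to be an identity in the group. *)
Lemma slope_noninj m h g i k : (i < n.*2)%N -> Cell m h g -> slope i k h ->
  exists a g1 g2, [/\ 0 < a, Cell m h g1, Cell m h g2, same_span (ugen i a *m g1) g2
    & ugen i a *m g1 <> g2].
Proof.
elim/ltn_ind: m => m IH in h g i k * => i2 Cg s.
have k2 := slope_bound i2 Cg s; have aik : adj i k by case/and3P: s.
have [m' [j [h' [b [g' [me he ge1 Cg' [j2 b0 vj alt]]]]]]] := slope_cases i2 Cg s.
have inj l x (y z : M2) : ugen l x *m y = ugen l x *m z -> y = z.
  by move/(congr1 (mulmx (ugen l (- x)))); rewrite !mulmxA ugenK !mul1mx.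
subst m h g; case: alt => [[fij s']|[jk alt]].
  have [a [g1 [g2 [a0 C1 C2 s12 n12]]]] := IH m' (ltnSn _) _ _ _ _ i2 Cg' s'.
  exists a, (ugen j b *m g1), (ugen j b *m g2).
  rewrite ugen_far_mull //; split=> //; [exact: CellS|exact: CellS|exact: same_span_mull|].
  by move/inj.
subst j; case: alt => [[m'' [h'' [c [g'' [k' [me he ge1 Cg'' [c0 vi s'']]]]]]]|[oi ci ck]].
  subst m' h' g'.
  have [|a [g1 [g2 [a0 C1 C2 s12 n12]]]] := IH m'' _ _ _ _ _ k2 Cg'' s''; first by lia.
  have d0 : 0 < b + a + b * c * a by rewrite !addr_gt0 // !mulr_gt0.
  exists (c * a / (b + a + b * c * a)).
  exists (ugen k (b + a + b * c * a) *m (ugen i (b * c / (b + a + b * c * a)) *m g1)).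
  exists (ugen k b *m (ugen i c *m g2)).
  have E : ugen i (c * a / (b + a + b * c * a)) *m
      (ugen k (b + a + b * c * a) *m (ugen i (b * c / (b + a + b * c * a)) *m g1)) =
      ugen k b *m (ugen i c *m (ugen k a *m g1)).
    by rewrite !mulmxA -ugen_braid ?gt_eqF // 1?adjC.
  rewrite E; split.
  - by rewrite !divr_gt0 // !mulr_gt0.
  - by apply: CellS => //; apply: CellS => //; rewrite !divr_gt0 // !mulr_gt0.
  - by apply: CellS => //; apply: CellS.
  - by do 2!apply: same_span_mull.
  - by move=> /inj /inj.
have b2 : 0 < 2 * b by rewrite mulr_gt0.
exists (2 * b)^-1, (ugen k (2 * b) *m g'), (ugen k b *m g').
have E : ugen i (2 * b)^-1 *m (ugen k (2 * b) *m g') = g' *m (ugen i (2 * b)^-1 *m ugen k (2 * b)).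
  by rewrite (comm_ugen _ ck) mulmxA (comm_ugen _ ci) -mulmxA.
rewrite E (comm_ugen b ck); split; [by rewrite invr_gt0| exact: CellS | | |].
- by rewrite -(comm_ugen b ck); apply: CellS.
- apply: same_span_mull; have {3}-> : b = 2 * b / (1 + (2 * b)^-1 * (2 * b)).
    by field; rewrite gt_eqF.
  by apply: same_span_series; rewrite // mulVf ?gt_eqF.
- have ug := Cell_unit Cg'.
  move/(congr1 (mulmx (invmx g'))); rewrite !mulKmx //; apply: ugen_series_neq => //.
  by rewrite invr_eq0 gt_eqF.
Qed.

(** The third case is a peak of height 1, at the bottom of the path. *)
Lemma shape_cases m h g i : (i < n.*2)%N -> Cell m h g ->
  [\/ valley i h, peak i h,
      ~~ odd i /\ [/\ h i = 0, h i.+1 = 1 & h i.+2 = 0]%N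
    | exists k, slope i k h].
Proof.
move=> i2 Cg; have [H0 H1 H2 Ho] := Cell_path Cg.
have h1 := H1 i; have h2 := H1 i.+1; have o := Ho i.+1.
case: h1 h2 => e1 [e2|e2].
- apply: Or44; exists i.+1; rewrite /slope /adj (_ : (i.*2.+1 - i.+1)%N = i); last lia.
  by rewrite eqxx; lia.
- case: (ltnP 1 (h i.+1)) => hi; first by apply: Or42; rewrite /peak; lia.
  by apply: Or43; split; [move: o => /=|split]; lia.
- by apply: Or41; rewrite /valley; lia.
- apply: Or44; exists i.-1; case: i i2 e1 e2 o => [|i] i2 e1 e2 o.
    by move: e1; rewrite H0.
  rewrite /slope /adj (_ : (i.+1.*2.+1 - i.+1.-1)%N = i.+3); last lia.
  by rewrite /=; lia.
Qed.

Lemma bump_id m h g i : (i < n.*2)%N -> Cell m h g -> ~~ valley i h -> bump i h = h.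
Proof.
move=> i2 Cg; have [H0 H1 H2 Ho] := Cell_path Cg.
have h1 := H1 i; have h2 := H1 i.+1.
by rewrite /valley => v; apply/funext => j; rewrite /bump; case: eqP => // ->; lia.
Qed.

Lemma low_fixed m h g i a : (i < n.*2)%N -> Cell m h g -> ~~ odd i ->
  (h i = 0)%N -> (h i.+1 = 1)%N -> (h i.+2 = 0)%N ->
  ugen i a *m g = g *m ugen i a /\ same_span (ugen i a *m g) g.
Proof.
move=> i2 Cg oi z0 z1 z2.
have ci : egen i *m g = g *m egen i by apply: (Cell_low i2 Cg); lia.
rewrite (comm_ugen a ci); split=> //; rewrite -{2}[g]mulmx1.
by apply/same_span_mull/same_span_even.
Qed.

(** With [bump_pull]: a factor u_i acts on images of cells as the min-plus rule acts on paths. *)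
Lemma bump_push m h g i a : (i < n.*2)%N -> 0 < a -> Cell m h g ->
  exists m' g', Cell m' (bump i h) g' /\ same_span (ugen i a *m g) g'.
Proof.
move=> i2 a0 Cg; case: (boolP (valley i h)) => [v|nv].
  by exists m.+1, (ugen i a *m g); split; [exact: CellS|exact: same_span_refl].
rewrite (bump_id i2 Cg nv); exists m.
case: (shape_cases i2 Cg) => [v|p|[oi [z0 z1 z2]]|[k s]].
- by rewrite v in nv.
- have [m' [b [g' [me b0 Cg' ge1]]]] := Cell_peak i2 Cg p.
  subst m g; rewrite mulmxA ugenD; eexists; split; last exact: same_span_refl.
  rewrite -[h](bump_unbump p); apply: CellS => //; first exact: addr_gt0.
  exact: valley_unbump.
- by exists g; split=> //; case: (low_fixed a i2 Cg oi z0 z1 z2).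
- by have [g' Cg' s'] := slope_push i2 a0 Cg s; exists g'.
Qed.

Lemma bump_pull m0 h g0 m g i : (i < n.*2)%N -> Cell m0 h g0 -> Cell m (bump i h) g ->
  exists a m' g', [/\ 0 < a, Cell m' h g' & same_span (ugen i a *m g') g].
Proof.
move=> i2 C0 Cg; case: (boolP (valley i h)) => [v|nv].
  have [m' [a [g' [_ a0 Cg' ->]]]] := Cell_peak i2 Cg (peak_bump v).
  by rewrite unbump_bump // in Cg'; exists a, m', g'; split=> //; exact: same_span_refl.
move: Cg; rewrite (bump_id i2 C0 nv) => Cg.
case: (shape_cases i2 Cg) => [v|p|[oi [z0 z1 z2]]|[k s]].
- by rewrite v in nv.
- have [m' [b [g' [me b0 Cg' ge1]]]] := Cell_peak i2 Cg p.
  exists (b / 2), m, (ugen i (b / 2) *m g'); split.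
  + by rewrite divr_gt0.
  + subst m; rewrite -[h](bump_unbump p); apply: CellS => //.
      by rewrite divr_gt0.
    exact: valley_unbump.
  + rewrite ge1 mulmxA ugenD -splitr; exact: same_span_refl.
- by exists 1, m, g; split=> //; case: (low_fixed 1 i2 Cg oi z0 z1 z2).
- by have [a [g' [a0 Cg' s']]] := slope_pull i2 Cg s; exists a, m, g'.
Qed.

Lemma bump_noninj m h g i : (i < n.*2)%N -> Cell m h g -> ~~ valley i h -> ~~ peak i h ->
  exists a m1 m2 g1 g2, [/\ 0 < a, Cell m1 h g1, Cell m2 h g2, same_span (ugen i a *m g1) g2
    & ugen i a *m g1 <> g2].
Proof.
move=> i2 Cg nv np; case: (shape_cases i2 Cg) => [v|p|[oi [z0 z1 z2]]|[k s]].
- by rewrite v in nv.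
- by rewrite p in np.
- exists 1, m, m, g, g; have [e s1] := low_fixed 1 i2 Cg oi z0 z1 z2.
  split=> //; rewrite e -{2}[g]mulmx1 => /(congr1 (mulmx (invmx g))).
  rewrite !mulKmx ?(Cell_unit Cg) // /ugen -{2}[1%:M]addr0 => /addrI /eqP.
  by rewrite scale1r (negPf (egen_neq0 _ i2)).
- have [a [g1 [g2 [*]]]] := slope_noninj i2 Cg s.
  by exists a, m, m, g1, g2.
Qed.

Lemma Cell_pivot m h g l : Cell m h g -> (l < n.*2)%N ->
  pivot l (g *m base_mx R n) = (h l.+2 == (h l.+1).+1).
Proof.
move=> Cg; elim: Cg l => [|{}m i {}h {}g a i2 a0 v Cg IH] l l2.
  by rewrite mul1mx pivot_base // /height0 /=; case: odd.
have [H0 H1 H2 Ho] := Cell_path Cg.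
case: i => [|i] in i2 v *; first by move: v; rewrite /valley H0.
move: (v) => /andP[/eqP v1 /eqP v2]; rewrite -mulmxA.
have [|||p1 p2] := @pivot_valley R n i a (g *m base_mx R n) i2.
- by rewrite gt_eqF.
- by rewrite IH ?(ltnW i2) //; lia.
- by rewrite IH // v2 eqxx.
case: (l =P i) => [->|li]; first by rewrite p1 bumpE bumpN; lia.
case: (l =P i.+1) => [->|li1]; first by rewrite (negPf p2) bumpE bumpN; lia.
rewrite pivot_ugen //; try lia.
by rewrite IH // !bumpN //; lia.
Qed.

Lemma Cell_disjoint m h g m' h' g' : Cell m h g -> Cell m' h' g' -> same_span g g' -> h = h'.
Proof.
move=> C C' [P uP e].
have [H0 H1 H2 Ho] := Cell_path C; have [H0' H1' H2' Ho'] := Cell_path C'.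
have E l : (l < n.*2)%N -> (h l.+2 == (h l.+1).+1) = (h' l.+2 == (h' l.+1).+1).
  by move=> l2; rewrite -(Cell_pivot C) // -(Cell_pivot C') // e pivot_mulr.
apply/funext => j; case: (ltnP n.*2 j) => [nj|]; first by rewrite H2 // H2'.
elim: j => [|j IH] j2; first by rewrite H0 H0'.
case: j => [|j] in IH j2 *; first by case: (H1 0%N) (H1' 0%N) => ? [] ?; lia.
have := IH (ltnW j2); have := E j (ltnW j2); case: (H1 j.+1) (H1' j.+1) => ? [] ?; lia.
Qed.

(** If a < b, moving u_i(a) to the other side would put one and the same subspace in the cell of
    h and in the cell of its bump. *)
Lemma Cell_valley_inj m h g m' g' i a b : (i < n.*2)%N -> valley i h ->
  Cell m h g -> Cell m' h g' -> same_span (ugen i a *m g) (ugen i b *m g') -> a = b.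
Proof.
move=> i2 v; wlog ab : m g m' g' a b / a <= b.
  move=> W C C' s; case/orP: (le_total a b) => ab; first exact: (W _ _ _ _ _ _ ab C C').
  by apply/esym; apply: (W _ _ _ _ _ _ ab C' C); apply: same_span_sym.
move=> C C' s; move: ab; rewrite le_eqVlt => /orP[/eqP//|ab]; exfalso.
have : same_span g (ugen i (b - a) *m g').
  have := same_span_mull (ugen i (- a)) s; rewrite !mulmxA ugenK mul1mx ugenD.
  by rewrite addrC.
have Cb : Cell m'.+1 (bump i h) (ugen i (b - a) *m g') by apply: CellS; rewrite ?subr_gt0.
move=> /(Cell_disjoint C Cb) /(congr1 (fun f => f i.+1)).
by move: v => /andP[/eqP v1 /eqP v2]; rewrite bumpE; lia.
Qed.

Lemma Cell_inj m h g m' g' : Cell m h g -> Cell m' h g' -> same_span g g' -> g = g'.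
Proof.
move=> C; elim: C m' g' => [|{}m i {}h {}g a i2 a0 v C IH] m' g'.
  by move=> /Cell_height0->.
move=> C' s; have [m1 [b [g1 [_ b0 C1 e]]]] := Cell_peak i2 C' (peak_bump v).
rewrite unbump_bump // in C1; subst g'.
have ab := Cell_valley_inj i2 v C C1 s; subst b; congr (_ *m _).
apply: IH C1 _; have := same_span_mull (ugen i (- a)) s.
by rewrite !mulmxA ugenK !mul1mx.
Qed.

End Cells.

(** * Reduced words, heights and efficient permutations *)

Section Words.
Variable n : nat.
Local Notation S := 'S_(n.*2.+1).
Local Notation I := 'I_(n.*2.+1).
Implicit Types (w v : S) (i j : 'I_(n.*2)) (a b : I).
Local Notation s := (@simple_refl n).
Local Notation vl i := (inord i : I).
Local Notation vr i := (inord (nat_of_ord i).+1 : I).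

(** The value i sits to the left of the value i + 1, so that s_i w is longer than w. *)
Definition ascent w i : bool := ((w^-1)%g (vl i) < (w^-1)%g (vr i))%N.

Lemma vlE i : vl i = i :> nat. Proof. by rewrite inordK //; have := ltn_ord i; lia. Qed.
Lemma vrE i : vr i = i.+1 :> nat. Proof. by rewrite inordK //; have := ltn_ord i; lia. Qed.

Lemma vl_neq_vr i : vl i != vr i.
Proof. by rewrite -val_eqE /= vlE vrE; lia. Qed.

Lemma simple_reflE i a : s i a =
  (if a == i :> nat then i.+1 else if a == i.+1 :> nat then i : nat else a) :> nat.
Proof.
rewrite /simple_refl; case: tpermP => [->|->|/eqP n1 /eqP n2].
- by rewrite vlE vrE eqxx.
- by rewrite vlE vrE eqxx (_ : (i.+1 == i) = false) //; lia.
- by move: n1 n2; rewrite -!val_eqE /= vlE vrE => /negPf-> /negPf->.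
Qed.

(** An adjacent transposition preserves the order of all pairs but one. *)
Lemma simple_refl_lt i a b : (a < b)%N ->
  ~ (a = i :> nat /\ b = i.+1 :> nat) -> (s i a < s i b)%N.
Proof.
move=> ab; rewrite !simple_reflE.
by case: (a =P i :> nat); case: (a =P i.+1 :> nat); case: (b =P i :> nat);
  case: (b =P i.+1 :> nat); lia.
Qed.

Lemma simple_reflV i : (s i)^-1%g = s i.
Proof. exact: tpermV. Qed.

Lemma simple_reflK w i : (w * s i * s i)%g = w.
Proof. by rewrite -mulgA -{2}(simple_reflV i) mulgV mulg1. Qed.

Lemma posM w i a : ((w * s i)^-1)%g a = (w^-1)%g (s i a).
Proof. by rewrite invMg simple_reflV permM. Qed.

Lemma posMl w i : ((w * s i)^-1)%g (vl i) = (w^-1)%g (vr i).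
Proof. by rewrite posM tpermL. Qed.

Lemma posMr w i : ((w * s i)^-1)%g (vr i) = (w^-1)%g (vl i).
Proof. by rewrite posM tpermR. Qed.

Lemma tperm_simple_refl i a b : (tperm (s i a) (s i b) * s i = s i * tperm a b)%g.
Proof. by rewrite -tpermJ conjgE simple_reflV mulgA simple_reflK. Qed.

(** The exchange condition: as letters are removed from the front, the inverted pair (a, b) must
    at some point be the pair exchanged by the letter, which can then be dropped. *)
Lemma exchange (x : seq 'I_(n.*2)) a b : (a < b)%N ->
  (((word_perm x)^-1)%g b < ((word_perm x)^-1)%g a)%N ->
  exists2 y, size x = (size y).+1 & word_perm y = (word_perm x * tperm a b)%g.
Proof.
elim: x a b => [|j x IH] a b ab /=; first by rewrite invg1 !perm1; lia.
rewrite !posM => lt.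
case: (a =P vl j) => [ea|na].
  case: (b =P vr j) => [eb|nb].
    by exists x; rewrite // ea eb -/(s j) simple_reflK.
  have sab : (s j a < s j b)%N.
    by apply: simple_refl_lt => // -[_ e]; apply: nb; apply: val_inj; rewrite /= e vrE.
  have [y sy ey] := IH _ _ sab lt; exists (j :: y); rewrite /= ?sy //.
  by rewrite ey -!mulgA tperm_simple_refl.
have sab : (s j a < s j b)%N.
  by apply: simple_refl_lt => // -[e _]; apply: na; apply: val_inj; rewrite /= e vlE.
have [y sy ey] := IH _ _ sab lt; exists (j :: y); rewrite /= ?sy //.
by rewrite ey -!mulgA tperm_simple_refl.
Qed.

Lemma reduced_cons w i x : reduced_word w (i :: x) ->
  [/\ reduced_word (word_perm x) x, ascent (word_perm x) i & w = (word_perm x * s i)%g].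
Proof.
case=> /= ew mw; split=> //.
  split=> // y ey; have := mw (i :: y); rewrite /= ey ew ltnS; exact.
rewrite /ascent ltnNge leq_eqVlt; apply/negP => /orP[/eqP/val_inj/perm_inj e|lt].
  by have := vl_neq_vr i; rewrite e eqxx.
have [|y sy ey] := exchange _ lt; first by rewrite vlE vrE.
by have := mw y; rewrite ey -ew => /(_ erefl); rewrite sy; lia.
Qed.

Lemma reduced_asc w i x : reduced_word w x -> ascent w i -> reduced_word (w * s i)%g (i :: x).
Proof.
case=> ew mw aw; split=> [|y ey]; first by rewrite /= ew.
have [||z sz ez] := @exchange y (vl i) (vr i); first by rewrite vlE vrE.
  by rewrite ey posMl posMr.
by rewrite sz /= ltnS; apply: mw; rewrite ez ey -/(s i) simple_reflK.
Qed.

Lemma word_perm_cat (x y : seq 'I_(n.*2)) :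
  word_perm (x ++ y) = (word_perm y * word_perm x)%g.
Proof. by elim: x => [|i x IH] /=; rewrite ?mulg1 // IH mulgA. Qed.

Lemma word_perm_surj w : exists x, word_perm x = w.
Proof.
have T (d : nat) a b : b = (a + d.+1)%N :> nat -> exists x, word_perm x = tperm a b.
  elim: d a b => [|d IH] a b ab.
    have a2 : (a < n.*2)%N by have := ltn_ord b; lia.
    exists [:: Ordinal a2]; rewrite /= mul1g /simple_refl.
    by congr tperm; apply: val_inj; rewrite /= inordK //; lia.
  have b2 : (b.-1 < n.*2)%N by have := ltn_ord b; lia.
  have [i ei] : exists i : 'I_(n.*2), i = b.-1 :> nat by exists (Ordinal b2).
  have [|x ex] := IH a (vl i); first by rewrite vlE; lia.
  exists (i :: x ++ [:: i]); rewrite /= word_perm_cat /= mul1g ex.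
  have -> : b = s i (vl i) by apply: val_inj; rewrite /= simple_reflE vlE eqxx; lia.
  have {2}-> : a = s i a.
    by apply: val_inj; rewrite /= simple_reflE;
      case: (a =P i :> nat); case: (a =P i.+1 :> nat); lia.
  by rewrite -tpermJ conjgE simple_reflV mulgA.
have {}T a b : exists x, word_perm x = tperm a b.
  case: (ltngtP a b) => ab.
  - by apply: (T (b - a).-1); lia.
  - by rewrite tpermC; apply: (T (a - b).-1); lia.
  - by exists [::]; rewrite (val_inj ab) tperm1.
have [ts -> _] := prod_tpermP w.
elim: ts => [|t ts [x ex]]; first by exists [::]; rewrite big_nil.
by have [y ey] := T t.1 t.2; exists (x ++ y); rewrite big_cons word_perm_cat ex ey.
Qed.

Lemma reduced_exists w : exists x, reduced_word w x.
Proof.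
pose P k := `[< exists2 x, size x = k & word_perm x = w >].
have exP : exists k, P k.
  by have [x ex] := word_perm_surj w; exists (size x); apply/asboolP; exists x.
case: (ex_minnP exP) => k /asboolP[x sx ex] mk; exists x; split=> // y ey.
by rewrite sx; apply: mk; apply/asboolP; exists y.
Qed.

(** Reduced words build every permutation through ascents. *)
Lemma ascent_ind (P : S -> Prop) : P 1%g ->
  (forall w i, ascent w i -> P w -> P (w * s i)%g) -> forall w, P w.
Proof.
move=> P1 PS w; have [x] := reduced_exists w; elim: x w => [|i x IH] w rx.
  by case: rx => <-.
by have [r a ->] := reduced_cons rx; apply: PS => //; apply: IH.
Qed.

Fixpoint min_upto (f : nat -> nat) m : nat :=
  if m is m'.+1 then minn (min_upto f m') (f m) else f 0%N.

Lemma min_upto_le f m k : (k <= m)%N -> (min_upto f m <= f k)%N.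
Proof.
elim: m => [|m IH] /=; first by rewrite leqn0 => /eqP->.
by rewrite leq_eqVlt => /orP[/eqP->|/IH]; lia.
Qed.

Lemma min_upto_ge f m c : (forall k, (k <= m)%N -> (c <= f k)%N) -> (c <= min_upto f m)%N.
Proof.
elim: m => [|m IH] H /=; first exact: H.
by rewrite leq_min H // IH // => k km; apply: H; lia.
Qed.

Lemma eq_min_upto f g m : f =1 g -> min_upto f m = min_upto g m.
Proof. by move=> e; elim: m => [|m IH] /=; rewrite ?IH e. Qed.

Lemma min_upto_minn f g m :
  min_upto (fun k => (minn (f k) (g k)).+1) m = (minn (min_upto f m) (min_upto g m)).+1.
Proof. by elim: m => [|m /= ->] //; lia. Qed.

(** The size of the symmetric difference of the values below j and the values at the
    first k positions. *)
Definition dist w (j k : nat) : nat :=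
  (\sum_(a : I) ((a < j) (+) ((w^-1)%g a < k)))%N.

(** The height function at which the min-plus rule arrives along any reduced word of w; it is
    continued by the zigzag beyond the last vertex. *)
Definition height w (j : nat) : nat :=
  if (j <= n.*2.+1)%N then min_upto (fun k => (dist w j k + odd k)%N) n.*2.+1 else odd j.

Lemma distM w i (j k : nat) : dist (w * s i)%g j k =
  (\sum_(a : I) ((s i a < j) (+) ((w^-1)%g a < k)))%N.
Proof.
rewrite /dist (reindex_inj (@perm_inj _ (s i))) /=; apply: eq_bigr => a _.
by rewrite posM tpermK.
Qed.

Lemma distM_neq w i (j k : nat) : j != i.+1 -> dist (w * s i)%g j k = dist w j k.
Proof.
move=> ji; rewrite distM; apply: eq_bigr => a _; congr (nat_of_bool (_ (+) _)).
by rewrite simple_reflE; case: (a =P i :> nat); case: (a =P i.+1 :> nat); lia.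
Qed.

(** Only the values i and i + 1 matter, and at an ascent the position of i is among the first k
    as soon as that of i + 1 is. *)
Lemma distM_asc w i (k : nat) : ascent w i ->
  dist (w * s i)%g i.+1 k = (minn (dist w i k) (dist w i.+2 k)).+1.
Proof.
rewrite /ascent => aw; rewrite distM /dist.
have sp (F : I -> nat) :
    (\sum_a F a = F (vl i) + (F (vr i) + \sum_(a | (a != vl i) && (a != vr i)) F a))%N.
  rewrite (bigD1 (vl i)) //=; congr (_ + _)%N; rewrite (bigD1 (vr i)) //=.
  by rewrite eq_sym vl_neq_vr.
rewrite !sp tpermL tpermR vlE vrE.
set A := (\sum_(_ | _) _)%N; set B := (\sum_(_ | _) _)%N; set C := (\sum_(_ | _) _)%N.
have nn a : (a != vl i) && (a != vr i) -> a <> i :> nat /\ a <> i.+1 :> nat.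
  by rewrite -!val_eqE /= vlE vrE => /andP[/eqP ? /eqP ?].
have -> : A = B.
  apply: eq_bigr => a /nn[n1 n2]; congr (nat_of_bool (_ (+) _)).
  by rewrite simple_reflE; case: (a =P i :> nat); case: (a =P i.+1 :> nat); lia.
have -> : C = B.
  apply: eq_bigr => a /nn[n1 n2]; congr (nat_of_bool (_ (+) _)); lia.
move: aw; set p := (w^-1)%g (vl i); set q := (w^-1)%g (vr i) => pq.
rewrite !(ltnn, ltnS, leqnn, leqnSn) (_ : (i.+1 < i)%N = false) /=; last lia.
by case: (ltnP p k) (ltnP q k) => ? [] ? /=; lia.
Qed.

Lemma heightM w i : ascent w i -> height (w * s i)%g = bump i (height w).
Proof.
move=> aw; apply/funext => j; rewrite /bump /height; have i2 := ltn_ord i.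
case: (j =P i.+1) => [->|/eqP ji]; last first.
  by case: ifP => // _; apply: eq_min_upto => k; rewrite distM_neq.
rewrite !ifT; try lia.
rewrite -min_upto_minn; apply: eq_min_upto => k; rewrite distM_asc //; lia.
Qed.

Lemma height1 : height 1%g = height0.
Proof.
apply/funext => j; rewrite /height /height0; case: ifP => // j2.
apply/eqP; rewrite eqn_leq; apply/andP; split.
  apply: leq_trans (min_upto_le _ j2) _; rewrite /dist big1 // => a _.
  by rewrite invg1 perm1 addbb.
apply: min_upto_ge => k k2; case oj: (odd j) => //; case ok: (odd k) => /=; first lia.
rewrite addn0 lt0n; apply/negP => /eqP d0.
have jk : j <> k by move=> e; rewrite e ok in oj.
have l : (minn j k < n.*2.+1)%N by lia.
have : (((Ordinal l < j) (+) (Ordinal l < k)) <= dist 1%g j k)%N.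
  by rewrite /dist (bigD1 (Ordinal l)) //= invg1 perm1 leq_addr.
rewrite d0 /=; case: (ltnP (minn j k) j) (ltnP (minn j k) k) => ? [] ? //; lia.
Qed.

(** All comparisons implied by efficiency: two positions in increasing order have
    increasing values, unless the left one is odd and the right one even. *)
Lemma efficient_lt w : efficient w <->
  forall a b, (a < b)%N -> ~~ (odd a && ~~ odd b) -> (w a < w b)%N.
Proof.
split=> [[e1 e2]|H]; last first.
  split=> a b; first by move=> e; apply: H; lia.
  by move=> oa e; apply: H; lia.
have same_par (d : nat) a b : b = (a + d.+1.*2)%N :> nat -> (w a < w b)%N.
  elim: d b => [|d IH] b ab; first by apply: e1; lia.
  have c2 : (b.-2 < n.*2.+1)%N by have := ltn_ord b; lia.
  apply: (@ltn_trans (w (Ordinal c2))); first by apply: IH => /=; lia.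
  by apply: e1 => /=; lia.
move=> a b ab; case: (boolP (odd a == odd b)) => o.
  by move=> _; apply: (same_par ((b - a)./2.-1)); lia.
move=> q2; have c2 : (a.+1 < n.*2.+1)%N by have := ltn_ord b; lia.
have l1 : (w a < w (Ordinal c2))%N by apply: e2 => //; lia.
case: (b =P Ordinal c2) => [->//|bc].
apply: ltn_trans l1 _; apply: (same_par ((b - a.+1)./2.-1)) => /=.
have : b <> a.+1 :> nat by move=> e; apply: bc; apply: val_inj.
lia.
Qed.

Lemma efficient1 : efficient (1%g : S).
Proof. by apply/efficient_lt => a b; rewrite !perm1. Qed.

(** The two values exchanged by s_i are adjacent and in the wrong order, which efficiency
    permits only at an odd position followed by an even one. *)
Lemma efficient_down w i : efficient (w * s i)%g -> ascent w i ->
  [/\ efficient w, odd ((w^-1)%g (vl i)) & ~~ odd ((w^-1)%g (vr i))].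
Proof.
move=> /efficient_lt e aw.
have eq1 : (w * s i)%g ((w^-1)%g (vl i)) = vr i by rewrite permM permKV tpermL.
have eq2 : (w * s i)%g ((w^-1)%g (vr i)) = vl i by rewrite permM permKV tpermR.
have := e _ _ aw; rewrite eq1 eq2 vlE vrE => o.
have {}o : odd ((w^-1)%g (vl i)) && ~~ odd ((w^-1)%g (vr i)).
  by apply/negPn/negP => /o; lia.
move/andP: (o) => [q1 q2]; split=> //; apply/efficient_lt => c d cd ok.
have -> : w c = s i ((w * s i)%g c) by rewrite permM tpermK.
have -> : w d = s i ((w * s i)%g d) by rewrite permM tpermK.
apply: simple_refl_lt; first exact: e.
move=> [E1 E2].
have Ec : c = (w^-1)%g (vr i).
  by apply: (@perm_inj _ (w * s i)%g); rewrite eq2; apply: val_inj; rewrite /= E1 vlE.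
have Ed : d = (w^-1)%g (vl i).
  by apply: (@perm_inj _ (w * s i)%g); rewrite eq1; apply: val_inj; rewrite /= E2 vrE.
by move: aw cd; rewrite /ascent Ec Ed; lia.
Qed.

Lemma efficient_up w i : efficient w -> odd ((w^-1)%g (vl i)) ->
  ~~ odd ((w^-1)%g (vr i)) -> ascent w i /\ efficient (w * s i)%g.
Proof.
move=> /efficient_lt e q1 q2; split.
  rewrite /ascent ltnNge leq_eqVlt; apply/negP => /orP[/eqP/val_inj ee|lt].
    by move: q1; rewrite -ee (negPf q2).
  by have := e _ _ lt; rewrite q1 andbF !permKV vlE vrE => /(_ isT); lia.
apply/efficient_lt => c d cd ok; rewrite !permM; apply: simple_refl_lt; first exact: e.
move=> [E1 E2].
have Ec : c = (w^-1)%g (vl i).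
  by rewrite -[c](permK w); congr (_ _); apply: val_inj; rewrite /= E1 vlE.
have Ed : d = (w^-1)%g (vr i).
  by rewrite -[d](permK w); congr (_ _); apply: val_inj; rewrite /= E2 vrE.
by move: ok; rewrite Ec Ed q1 q2.
Qed.

(** For efficient w the height is the lattice path of w. *)
Lemma efficient_step w : efficient w -> forall a : I,
  if odd ((w^-1)%g a) then height w a = (height w a.+1).+1
  else height w a.+1 = (height w a).+1.
Proof.
elim/ascent_ind: w => [|w i aw IH] e a.
  by rewrite height1 invg1 perm1 /height0 /=; case: odd.
have [ew q1 q2] := efficient_down e aw.
have H1 := IH ew (vl i); have H2 := IH ew (vr i).
rewrite q1 vlE in H1; rewrite (negPf q2) vrE in H2.
rewrite heightM //; case: (a =P vl i) => [->|na].
  by rewrite posMl (negPf q2) vlE bumpE bumpN; lia.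
case: (a =P vr i) => [->|na2].
  by rewrite posMr q1 vrE bumpE bumpN; lia.
have -> : ((w * s i)^-1)%g a = (w^-1)%g a.
  by rewrite posM /simple_refl tpermD //; apply/eqP => /esym.
have n1 : a <> i :> nat by move=> ea; apply: na; apply: val_inj; rewrite /= vlE.
have n2 : a <> i.+1 :> nat by move=> ea; apply: na2; apply: val_inj; rewrite /= vrE.
by rewrite !bumpN; [exact: IH|lia|lia].
Qed.

Lemma efficient_valley w i : efficient w -> valley i (height w) ->
  odd ((w^-1)%g (vl i)) /\ ~~ odd ((w^-1)%g (vr i)).
Proof.
move=> e /andP[/eqP v1 /eqP v2].
have := efficient_step e (vl i); have := efficient_step e (vr i).
by rewrite vlE vrE; case: odd; case: odd; lia.
Qed.

Lemma valley_efficient w i : ascent w i -> efficient (w * s i)%g -> valley i (height w).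
Proof.
move=> aw e; have [ew q1 q2] := efficient_down e aw.
have := efficient_step ew (vl i); have := efficient_step ew (vr i).
rewrite vlE vrE q1 (negPf q2) /valley; lia.
Qed.

(** The path tells which values sit at even positions, and on each parity class of positions an
    efficient permutation is increasing; so the two permutations agree position by position. *)
Lemma height_inj w v : efficient w -> efficient v -> height w = height v -> w = v.
Proof.
move=> ew ev ehwv.
have par a : odd ((w^-1)%g a) = odd ((v^-1)%g a).
  have := efficient_step ew a; have := efficient_step ev a.
  by rewrite ehwv; case: odd; case: odd => //; lia.
have one w1 v1 a : efficient w1 -> (forall b, odd ((w1^-1)%g b) = odd ((v1^-1)%g b)) ->
    (forall b, (b < a)%N -> v1 b = w1 b) -> ~ (v1 a < w1 a)%N.
  move=> /efficient_lt e1 p1 IH lt.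
  set b := (w1^-1)%g (v1 a); have wb : w1 b = v1 a by rewrite permKV.
  have pb : odd b = odd a by rewrite /b p1 permK.
  case: (ltngtP a b) => ab.
  - by have := e1 _ _ ab; rewrite pb andbN wb => /(_ isT); lia.
  - by have /perm_inj e := etrans (IH _ ab) wb; move: ab; rewrite e ltnn.
  - by move: lt; rewrite -wb (val_inj ab) ltnn.
apply/permP => a; move: {2}(a : nat).+1 (ltnSn a) => m.
elim: m a => // m IH a am; apply: val_inj => /=.
case: (ltngtP (w a) (v a)) => // lt; exfalso.
  by apply: (one v w a ev) lt => [b|b ba]; [rewrite par | apply: IH; lia].
by apply: (one w v a ew par) lt => b ba; apply/esym/IH; lia.
Qed.

End Words.

(** * The sets E(w) and the cells *)

Section CellsOfPerms.
Variables (R : realType) (n : nat).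
Local Notation M2 := 'M[R]_(n + n).
Local Notation S := 'S_(n.*2.+1).
Local Notation s := (@simple_refl n).
Local Notation ugen := (@ugen R n).
Local Notation Cell := (@Cell R n).
Implicit Types (w v : S) (i : 'I_(n.*2)) (g : M2) (a : R).

Lemma cellE1 : cellE R (1%g : S) 1%:M.
Proof.
by exists [::]; split=> //; rewrite big_nil.
Qed.

Lemma cellE_cons w i a g : ascent w i -> 0 < a -> cellE R w g ->
  cellE R (w * s i)%g (ugen i a *m g).
Proof.
move=> aw a0 [x [rx px ->]]; exists ((i, a) :: x); split.
- exact: reduced_asc.
- by move=> p; rewrite inE => /orP[/eqP->//|/px].
- by rewrite big_cons /= gen_uE.
Qed.

Lemma cellE_ind (P : S -> M2 -> Prop) : P 1%g 1%:M ->
  (forall w i a g, ascent w i -> 0 < a -> cellE R w g -> P w g -> P (w * s i)%g (ugen i a *m g)) ->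
  forall w g, cellE R w g -> P w g.
Proof.
move=> P1 PS w g [x [rx px ->]]; elim: x w rx px => [|[i a] x IH] w rx px.
  by case: rx => /= <- _; rewrite big_nil.
have [r aw ->] := reduced_cons rx.
have px' p : p \in x -> 0 < p.2 by move=> xp; apply: px; rewrite inE xp orbT.
rewrite big_cons /= gen_uE; apply: PS => //.
- by apply: (px (i, a)); rewrite inE eqxx.
- by exists x.
- exact: IH.
Qed.

Lemma cellE_nonempty w : exists g, cellE R w g.
Proof.
elim/ascent_ind: w => [|w i aw [g Eg]]; first by exists 1%:M; exact: cellE1.
by exists (ugen i 1 *m g); apply: cellE_cons.
Qed.

Lemma cellE_Cell w g : efficient w -> cellE R w g -> exists m, Cell m (height w) g.
Proof.
move=> ew Eg; elim/cellE_ind: Eg ew => {w g} [_|w i a g aw a0 _ IH ew].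
  by exists 0%N; rewrite height1; exact: Cell0.
have [ew' _ _] := efficient_down ew aw; have [m Cg] := IH ew'.
by exists m.+1; rewrite heightM //; apply: CellS => //; apply: valley_efficient.
Qed.

(** Every path of a cell is the path of an efficient permutation, because each valley is an ascent
    that keeps efficiency. *)
Lemma Cell_efficient m h g : Cell m h g ->
  exists w, [/\ efficient w, height w = h & cellE R w g].
Proof.
elim=> [|{}m i {}h {}g a i2 a0 v _ [w [ew hw Eg]]].
  by exists 1%g; split; [exact: efficient1|exact: height1|exact: cellE1].
pose j : 'I_(n.*2) := Ordinal i2; rewrite -hw in v *.
have [q1 q2] := @efficient_valley n w j ew v.
have [aw ew'] := efficient_up ew q1 q2.
by exists (w * s j)%g; split=> //; [rewrite heightM|apply: (@cellE_cons w j)].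
Qed.

Lemma Cell_cellE m w g : efficient w -> Cell m (height w) g -> cellE R w g.
Proof.
by move=> ew /Cell_efficient[v [ev /(height_inj ev ew) <- ]].
Qed.

(** With [Cell_same_cellE]: E(w) and the cell of the path of w have the same image, whether
    or not w is efficient. *)
Lemma cellE_same_Cell w g : cellE R w g -> exists m g', Cell m (height w) g' /\ same_span g g'.
Proof.
elim/cellE_ind => {w g} [|w i a g aw a0 _ [m [g' [Cg' sg]]]].
  by exists 0%N, 1%:M; rewrite height1; split; [exact: Cell0|exact: same_span_refl].
have [m' [g'' [C'' s'']]] := bump_push (ltn_ord i) a0 Cg'.
exists m', g''; rewrite heightM //; split=> //.
by apply: same_span_trans s''; apply: same_span_mull.
Qed.

Lemma Cell_same_cellE w m g' : Cell m (height w) g' -> exists2 g, cellE R w g & same_span g g'.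
Proof.
elim/ascent_ind: w m g' => [|w i aw IH] m g'.
  rewrite height1 => /Cell_height0->.
  by exists 1%:M; [exact: cellE1|exact: same_span_refl].
rewrite heightM //; have [g0 /cellE_same_Cell[m0 [g1 [C1 _]]]] := cellE_nonempty w.
case/(bump_pull (ltn_ord i) C1) => a [m' [g2 [a0 C2 s2]]].
have [g Eg sg] := IH _ _ C2; exists (ugen i a *m g); first exact: cellE_cons.
by apply: same_span_trans s2; apply: same_span_mull.
Qed.

Lemma cellE_inj w g g' : efficient w -> cellE R w g -> cellE R w g' -> same_span g g' -> g = g'.
Proof.
by move=> ew /(cellE_Cell ew)[m C] /(cellE_Cell ew)[m' C']; apply: Cell_inj C C'.
Qed.

Lemma cellE_disjoint w v g g' : efficient w -> efficient v ->
  cellE R w g -> cellE R v g' -> same_span g g' -> w = v.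
Proof.
move=> ew ev /(cellE_Cell ew)[m C] /(cellE_Cell ev)[m' C'] /(Cell_disjoint C C').
exact: height_inj.
Qed.

(** Along a reduced word of w take the first letter that destroys efficiency.  It acts neither on a
    valley, which would keep efficiency, nor on a high peak, which would be a descent. *)
Lemma cellE_noninj w : ~ efficient w ->
  exists g g', [/\ cellE R w g, cellE R w g', same_span g g' & g <> g'].
Proof.
elim/ascent_ind: w => [/(_ (efficient1 n))//|w i aw IH new].
have i2 := ltn_ord i.
have inj x (y z : M2) : ugen i x *m y = ugen i x *m z -> y = z.
  by move/(congr1 (mulmx (ugen i (- x)))); rewrite !mulmxA ugenK !mul1mx.
have [ew|/IH[g [g' [E1 E2 s12 n12]]]] := pselect (efficient w); last first.
  exists (ugen i 1 *m g), (ugen i 1 *m g'); split.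
  - exact: cellE_cons.
  - exact: cellE_cons.
  - exact: same_span_mull.
  - by move/inj.
have nv : ~~ valley i (height w).
  apply/negP => v; have [q1 q2] := efficient_valley ew v.
  by have [] := efficient_up ew q1 q2.
have [g0 /(cellE_Cell ew)[m C0]] := cellE_nonempty w.
have np : ~~ peak i (height w).
  apply/negP => p; have [m' [b [g1 [_ b0 C1 _]]]] := Cell_peak i2 C0 p.
  have [v [ev hv _]] := Cell_efficient C1.
  have vv : valley i (height v) by rewrite hv valley_unbump.
  have [q1 q2] := efficient_valley ev vv.
  have [av evi] := efficient_up ev q1 q2.
  have e : (v * s i)%g = w by apply: height_inj; rewrite // heightM // hv bump_unbump.
  by move: aw av; rewrite -e /ascent posMl posMr; lia.
have [a [m1 [m2 [g1 [g2 [a0 C1 C2 s12 n12]]]]]] := bump_noninj i2 C0 nv np.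
(* both elements need a positive factor u_i, hence the common extra u_i(1) *)
exists (ugen i (1 + a) *m g1), (ugen i 1 *m g2); split.
- by apply: cellE_cons => //; [rewrite addr_gt0|exact: Cell_cellE C1].
- by apply: cellE_cons => //; exact: Cell_cellE C2.
- by rewrite -ugenD -mulmxA; apply: same_span_mull.
- by rewrite -ugenD -mulmxA => /inj.
Qed.

End CellsOfPerms.

(** * Response matrices as Dirichlet-to-Neumann maps *)

Section Electrical.
Variables (R : realType) (n : nat).
Implicit Types (N : network R n) (k l : 'I_n.+1) (c : R) (phi : 'I_n.+1 -> R).

Definition edge_sign N (e : edge N) (x : vert N) : R :=
  (x == (ends e).1)%:R - (x == (ends e).2)%:R.

Definition voltage N (f : vert N -> R) (e : edge N) : R := f (ends e).1 - f (ends e).2.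

Definition laplacian N (f : vert N -> R) (x : vert N) : R :=
  \sum_(e : edge N) weight e * edge_sign e x * voltage f e.

Lemma sum_delta (T : finType) (y : T) (f : T -> R) : \sum_x (x == y)%:R * f x = f y.
Proof.
rewrite (bigD1 y) //= eqxx mul1r big1 ?addr0 // => x /negPf->.
by rewrite mul0r.
Qed.

Lemma sum_edge_sign N (f : vert N -> R) (e : edge N) : \sum_x edge_sign e x * f x = voltage f e.
Proof.
rewrite /edge_sign; under eq_bigr do rewrite mulrBl.
by rewrite sumrB !sum_delta.
Qed.

(** The Kirchhoff matrix is a sum of rank one matrices over the edges; loops contribute 0. *)
Lemma kirchhoffE N (x y : vert N) :
  kirchhoff x y = \sum_(e : edge N) weight e * edge_sign e x * edge_sign e y.
Proof.
rewrite /kirchhoff; case: eqP => [->|/eqP nxy].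
  rewrite [LHS]big_mkcond; apply: eq_bigr => e _; rewrite /edge_sign.
  case: (boolP [exists z, _]) => [/existsP[z /andP[zy]]|].
    rewrite /joins => /orP[]/eqP->; rewrite /= eqxx eq_sym (negPf zy);
    by rewrite ?subr0 ?sub0r ?mulr1 // mulrN1 mulrN1 opprK.
  move=> /existsPn H; case: (y =P (ends e).1) => e1; case: (y =P (ends e).2) => e2.
  - by rewrite subrr !mulr0.
  - have := H (ends e).2; rewrite /joins e1 -surjective_pairing eqxx andbT negbK.
    by move/eqP => e21; case: e2; rewrite e1 e21.
  - have := H (ends e).1; rewrite /joins e2 -surjective_pairing eqxx orbT andbT negbK.
    by move/eqP => e12; case: e1; rewrite e2 e12.
  - by rewrite subrr !mulr0.
rewrite [\sum_(e | _) _]big_mkcond -sumrN; apply: eq_bigr => e _.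
rewrite /joins /edge_sign; case: (ends e) => a b; rewrite !xpair_eqE /=.
rewrite ![a == _]eq_sym ![b == _]eq_sym.
case: (x =P a) => [xa|_].
  rewrite -xa [y == x]eq_sym (negPf nxy) /=.
  case: (x =P b) => [xb|_].
    by rewrite -xb [y == x]eq_sym (negPf nxy) /= subrr !(mul0r, mulr0) oppr0.
  by case: (y == b); rewrite /= ?subr0 ?sub0r ?mulr1 ?mulrN1 // oppr0 mulr0.
case: (x =P b) => [xb|_]; last by rewrite !andbF /= subrr !(mul0r, mulr0) oppr0.
rewrite -xb [y == x]eq_sym (negPf nxy) /= andbT.
by case: (y == a); rewrite /= ?subr0 ?sub0r ?mulr1 ?mulrN1 // ?mulr0 oppr0.
Qed.

Lemma kirchhoffC N (x y : vert N) : kirchhoff x y = kirchhoff y x.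
Proof. by rewrite !kirchhoffE; apply: eq_bigr => e _; rewrite mulrAC. Qed.

Lemma laplacianE N (f : vert N -> R) (x : vert N) :
  laplacian f x = \sum_y kirchhoff x y * f y.
Proof.
transitivity (\sum_y \sum_(e : edge N) weight e * edge_sign e x * edge_sign e y * f y).
  rewrite exchange_big; apply: eq_bigr => e _.
  by rewrite -sum_edge_sign mulr_sumr; apply: eq_bigr => y _; rewrite mulrA.
by apply: eq_bigr => y _; rewrite kirchhoffE mulr_suml.
Qed.

(** The dissipated power. *)
Lemma energyE N (f : vert N -> R) :
  \sum_x f x * laplacian f x = \sum_(e : edge N) weight e * voltage f e ^+ 2.
Proof.
transitivity (\sum_x \sum_(e : edge N) edge_sign e x * f x * (weight e * voltage f e)).
  by apply: eq_bigr => x _; rewrite mulr_sumr; apply: eq_bigr => e _; ring.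
rewrite exchange_big; apply: eq_bigr => e _.
by rewrite -mulr_suml sum_edge_sign mulrCA expr2.
Qed.

Lemma sum_vert N (F : vert N -> R) : injective (@bdry _ _ N) ->
  \sum_x F x = \sum_k F (bdry N k) + \sum_(i < #|interior_vert N|) F (enum_val i).
Proof.
move=> inj; rewrite (bigID (mem (interior_vert N))) /= addrC; congr (_ + _); last first.
  by rewrite [LHS]big_enum_val.
rewrite (eq_bigl (mem (codom (@bdry _ _ N)))); last by move=> x; rewrite inE negbK.
rewrite -big_uniq /=; last by rewrite map_inj_uniq // enum_uniq.
by rewrite big_map big_enum.
Qed.

Definition harmonic N (f : vert N -> R) : Prop :=
  forall x, x \in interior_vert N -> laplacian f x = 0.

Lemma bdry_not_interior N k : bdry N k \notin interior_vert N.
Proof. by rewrite inE negbK codom_f. Qed.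

(** The energy of such a function vanishes, so it is constant on connected components, each of which
    contains a boundary vertex. *)
Lemma harmonic_eq0 N (f : vert N -> R) : electrical N -> harmonic f ->
  (forall k, f (bdry N k) = 0) -> forall x, f x = 0.
Proof.
case=> inj w0 con hf f0.
have E0 : \sum_(e : edge N) weight e * voltage f e ^+ 2 = 0.
  rewrite -energyE sum_vert // big1 => [|k _]; last by rewrite f0 mul0r.
  by rewrite big1 ?addr0 // => i _; rewrite hf ?mulr0 // enum_valP.
have d0 (e : edge N) : voltage f e = 0.
  have ge0 (e' : edge N) : true -> 0 <= weight e' * voltage f e' ^+ 2.
    by move=> _; rewrite mulr_ge0 ?sqr_ge0 // ltW.
  have := psumr_eq0P ge0 E0 (i := e) isT.
  by move/eqP; rewrite mulf_eq0 sqrf_eq0 gt_eqF //= => /eqP.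
have fadj x y : Defs.adjacent x y -> f x = f y.
  case/existsP=> e; have /subr0_eq := d0 e.
  by rewrite /joins => de /orP[]/eqP ee; rewrite ee /= in de.
have fcon x y : connect (@Defs.adjacent _ _ N) x y -> f x = f y.
  case/connectP=> p; elim: p x => [|z p IH] x /=; first by move=> _ ->.
  by case/andP=> /fadj-> pz yE; exact: IH pz yE.
by move=> x; have [k /fcon->] := con x.
Qed.

Section Schur.
Variable N : network R n.
Hypothesis eN : electrical N.
Let m := #|interior_vert N|.
Let ii (i : 'I_m) : vert N := enum_val i.
Let KBI : 'M[R]_(n.+1, m) := \matrix_(i, j) kirchhoff (bdry N i) (ii j).
Let KIB : 'M[R]_(m, n.+1) := \matrix_(i, j) kirchhoff (ii i) (bdry N j).
Let KII : 'M[R]_m := \matrix_(i, j) kirchhoff (ii i) (ii j).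

Let extend (v : 'I_m -> R) phi (x : vert N) : R :=
  \sum_i v i * (x == ii i)%:R + \sum_k phi k * (x == bdry N k)%:R.

Let extend_int v phi i : extend v phi (ii i) = v i.
Proof.
rewrite /extend (bigD1 i) //= eqxx mulr1 big1 => [|j ji]; last first.
  by rewrite (inj_eq enum_val_inj) eq_sym (negPf ji) mulr0.
rewrite big1 ?addr0 // => k _; case: eqP => [e|]; rewrite ?mulr0 //.
by have := enum_valP i; rewrite -/(ii i) e (negPf (bdry_not_interior N k)).
Qed.

Let extend_bdry v phi k : extend v phi (bdry N k) = phi k.
Proof.
have [inj _ _] := eN; rewrite /extend addrC (bigD1 k) //= eqxx mulr1 big1 => [|j ji]; last first.
  by rewrite (inj_eq inj) eq_sym (negPf ji) mulr0.
rewrite big1 ?addr0 // => i _; case: eqP => [e|]; rewrite ?mulr0 //.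
by have := enum_valP i; rewrite -/(ii i) -e (negPf (bdry_not_interior N k)).
Qed.

Let KII_unit : KII \in unitmx.
Proof.
have [inj _ _] := eN; rewrite -row_free_unit; apply: inj_row_free => v vK.
pose f := extend (fun i => v 0 i) (fun=> 0).
have hf : harmonic f.
  move=> x xi; have -> : x = ii (enum_rank_in xi x) by rewrite /ii enum_rankK_in.
  set j := enum_rank_in _ _; rewrite laplacianE sum_vert //.
  rewrite big1 ?add0r => [|k _]; last by rewrite /f extend_bdry mulr0.
  move/matrixP: vK => /(_ 0 j); rewrite !mxE => e; rewrite -[RHS]e.
  apply: eq_bigr => i _.
  by rewrite -/(ii i) /f extend_int !mxE mulrC kirchhoffC.
have f0 := harmonic_eq0 eN hf (extend_bdry _ _).
by apply/matrixP => p q; rewrite ord1 !mxE -(f0 (ii q)) /f extend_int.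
Qed.

Let laplacian_split (f : vert N -> R) x :
  laplacian f x = \sum_k kirchhoff x (bdry N k) * f (bdry N k)
    + \sum_i kirchhoff x (ii i) * f (ii i).
Proof. by have [inj _ _] := eN; rewrite laplacianE sum_vert. Qed.

(** The Schur complement maps boundary potentials to boundary currents. *)
Lemma harmonic_response (f : vert N -> R) k : harmonic f ->
  laplacian f (bdry N k) = \sum_j response N k j * f (bdry N j).
Proof.
move=> hf; pose fB : 'cV[R]_n.+1 := \col_j f (bdry N j); pose fI : 'cV[R]_m := \col_i f (ii i).
have eI : KII *m fI = - (KIB *m fB).
  apply/eqP; rewrite -addr_eq0 addrC; apply/eqP/matrixP => i z; rewrite ord1 !mxE.
  rewrite -[RHS](hf (ii i) (enum_valP i)) laplacian_split.
  by congr (_ + _); apply: eq_bigr => j _; rewrite !mxE.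
have {}eI : fI = - (invmx KII *m (KIB *m fB)) by rewrite -mulmxN -eI mulKmx.
have -> : \sum_j response N k j * f (bdry N j) = (response N *m fB) k 0.
  by rewrite !mxE; apply: eq_bigr => j _; rewrite !mxE.
rewrite /response -/m mulmxBl -!mulmxA -/KIB -/KII -/KBI -mulmxN -eI laplacian_split !mxE.

by congr (_ + _); apply: eq_bigr => j _; rewrite !mxE.
Qed.

Lemma harmonic_extension phi :
  exists2 f : vert N -> R, harmonic f & forall k, f (bdry N k) = phi k.
Proof.
pose fI : 'cV[R]_m := - (invmx KII *m (KIB *m \col_j phi j)).
exists (extend (fun i => fI i 0) phi) => [x xi|k]; last exact: extend_bdry.
have -> : x = ii (enum_rank_in xi x) by rewrite /ii enum_rankK_in.
set i := enum_rank_in _ _; rewrite laplacian_split.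
have -> : \sum_j kirchhoff (ii i) (ii j) * extend (fun i => fI i 0) phi (ii j) = (KII *m fI) i 0.
  by rewrite !mxE; apply: eq_bigr => j _; rewrite extend_int !mxE.
have -> : KII *m fI = - (KIB *m \col_j phi j) by rewrite /fI mulmxN mulKVmx.
rewrite !mxE; apply/eqP; rewrite subr_eq0; apply/eqP.
by apply: eq_bigr => j _; rewrite extend_bdry !mxE.
Qed.

(** A response matrix is known once the currents of one harmonic extension of each boundary
    potential are; no order on the interior vertices is involved. *)
Lemma response_uniq (L : 'M[R]_n.+1) :
  (forall phi, exists f : vert N -> R, [/\ harmonic f, forall k, f (bdry N k) = phi k
     & forall k, laplacian f (bdry N k) = \sum_j L k j * phi j]) -> response N = L.
Proof.
move=> H; apply/matrixP => k j.
have [f [hf fB fL]] := H (fun l => (l == j)%:R).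
have := fL k; rewrite harmonic_response //.
under eq_bigr do rewrite fB mulrC; rewrite sum_delta => ->.
by under eq_bigr do rewrite mulrC; rewrite sum_delta.
Qed.

(** This entry is the energy of the harmonic extension of the indicator of k. *)
Lemma response_ge0 k : 0 <= response N k k.
Proof.
have [inj w0 _] := eN; have [f hf fB] := harmonic_extension (fun l => (l == k)%:R).
have -> : response N k k = \sum_x f x * laplacian f x.
  rewrite sum_vert // [X in _ + X]big1 ?addr0 => [|i _]; last first.
    by rewrite hf ?mulr0 // enum_valP.
  under eq_bigr do rewrite fB; rewrite sum_delta harmonic_response //.
  by under eq_bigr do rewrite fB mulrC; rewrite sum_delta.
by rewrite energyE sumr_ge0 // => e _; rewrite mulr_ge0 ?sqr_ge0 // ltW.
Qed.

End Schur.

Lemma sum_option (T : finType) (F : option T -> R) :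
  \sum_x F x = F None + \sum_x F (Some x).
Proof.
rewrite (bigD1 None) //=; congr (_ + _).
rewrite (reindex_omap Some id) => [|[x|]//].
by apply: eq_bigl => x; rewrite eqxx.
Qed.

Lemma laplacian_add_edge N k l c (f : vert N -> R) x :
  laplacian (N := add_edge k l c N) f x = laplacian f x
    + c * ((x == bdry N k)%:R - (x == bdry N l)%:R) * (f (bdry N k) - f (bdry N l)).
Proof. by rewrite /laplacian sum_option addrC. Qed.

Lemma electrical_add_edge N k l c : 0 < c -> electrical N -> electrical (add_edge k l c N).
Proof.
move=> c0 [inj w0 con]; split; [exact: inj|by case|move=> x].
have [j xj] := con x; exists j.
apply: connect_sub xj => {}x y /existsP[e je]; apply: connect1.
by apply/existsP; exists (Some e).
Qed.

Lemma response_add_edge N k l c : 0 < c -> electrical N ->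
  response (add_edge k l c N) = response N +
    c *: \matrix_(i, j) (((i == k)%:R - (i == l)%:R) * ((j == k)%:R - (j == l)%:R)).
Proof.
move=> c0 eN; have [inj _ _] := eN.
apply: (response_uniq (electrical_add_edge k l c0 eN)) => phi.
have [f hf fB] := harmonic_extension eN phi; exists f; split=> //.
  move=> x xi; rewrite laplacian_add_edge hf // add0r.
  have nb j : x == bdry N j = false.
    by apply/eqP => e; move: xi; rewrite e inE codom_f.
  by rewrite !nb subrr mulr0 mul0r.
have hr i : laplacian f (bdry N i) = \sum_j response N i j * phi j.
  by rewrite harmonic_response //; apply: eq_bigr => j _; rewrite fB.
move=> i; rewrite laplacian_add_edge hr !(inj_eq inj) !fB.
move: (response N) => L; under [in RHS]eq_bigr do rewrite !mxE mulrDl.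
rewrite big_split /=; congr (_ + _).
rewrite -(sum_delta k phi) -(sum_delta l phi) -sumrB mulr_sumr; apply: eq_bigr => j _; ring.
Qed.

Definition lift_spike N k c (f : vert N -> R) (a : R) (x : vert (add_spike k c N)) : R :=
  if x is Some y then f y else a.

Lemma laplacian_add_spike N k c (f : vert N -> R) (a : R) (x : vert (add_spike k c N)) :
  laplacian (lift_spike f a) x =
    if x is Some y then laplacian f y - c * (y == bdry N k)%:R * (a - f (bdry N k))
    else c * (a - f (bdry N k)).
Proof.
rewrite /laplacian sum_option /= addrC.
have E (z : option (vert N)) (y : vert N) :
    (z == Some y :> option _) = (if z is Some z' then z' == y else false).
  by case: z.
case: x => [y|].
  congr (_ + _); rewrite /edge_sign /voltage /= !E /=; ring.
rewrite big1 ?add0r => [|e _]; last by rewrite /edge_sign /= subrr mulr0 mul0r.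
by rewrite /edge_sign /voltage /= subr0 mulr1.
Qed.

Lemma electrical_add_spike N k c : 0 < c -> electrical N -> electrical (add_spike k c N).
Proof.
move=> c0 [inj w0 con]; split=> [i j|[d|]|]; [|exact: w0|exact: c0|].
  rewrite /=; case: eqP => [->|_]; case: eqP => [->|_] //.
  by case=> /inj.
have lift x y : connect (@Defs.adjacent _ _ N) x y ->
    connect (@Defs.adjacent _ _ (add_spike k c N)) (Some x) (Some y).
  case/connectP=> p; elim: p x => [|z p IH] x /=; first by move=> _ ->.
  case/andP=> /existsP[d xz] pz yE; apply: connect_trans (IH _ pz yE).
  apply/connect1/existsP; exists (Some d).
  by move: xz; rewrite /joins /= => /orP[]/eqP->; rewrite eqxx ?orbT.
have lk : connect (@Defs.adjacent _ _ (add_spike k c N)) (Some (bdry N k)) None.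
  by apply/connect1/existsP; exists None; rewrite /joins /= eqxx ?orbT.
case=> [x|]; last by exists k; rewrite /= eqxx connect0.
have [j xj] := con x; exists j; rewrite /=; case: eqP => [jk|_]; last exact: lift.
by rewrite jk in xj; apply: connect_trans lk; apply: lift.
Qed.

Lemma interior_add_spike N k c x : Some x \in interior_vert (add_spike k c N) ->
  x \in interior_vert N \/ x = bdry N k.
Proof.
rewrite !inE => xi; case: (x =P bdry N k) => [|xk]; first by right.
left; apply: contra xi => /codomP[j xj]; apply/codomP; exists j => /=.
by case: eqP => [jk|_]; [rewrite jk in xj | rewrite xj].
Qed.

Lemma None_not_interior N k c : None \notin interior_vert (add_spike k c N).
Proof. by rewrite inE negbK; apply/codomP; exists k; rewrite /= eqxx. Qed.

(** The old vertex k takes the potential at which the current through the spike, c times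
    the potential drop, equals the current into the old network. *)
Lemma response_add_spike N k c : 0 < c -> electrical N ->
  response (add_spike k c N) = response N -
    (c + response N k k)^-1 *: \matrix_(i, j) (response N i k * response N k j).
Proof.
move=> c0 eN; have [inj _ _] := eN; set L := response N.
have d0 : c + L k k != 0 by rewrite gt_eqF // ltr_pwDl // response_ge0.
apply: (response_uniq (electrical_add_spike k c0 eN)) => phi.
pose t := (\sum_j L k j * phi j) / (c + L k k).
have [f hf fB] := harmonic_extension eN (fun j => phi j - t * (j == k)%:R).
have Lf i : laplacian f (bdry N i) = \sum_j L i j * phi j - t * L i k.
  rewrite harmonic_response //; under eq_bigr do rewrite fB mulrBr.
  rewrite sumrB; congr (_ - _); rewrite -(sum_delta k (L i)) mulr_sumr.
  by apply: eq_bigr => j _; ring.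
have tE : \sum_j L k j * phi j = t * (c + L k k) by rewrite /t mulfVK.
exists (lift_spike f (phi k)); split.
- move=> [x|] xi; last by move: xi; rewrite (negPf (None_not_interior _ _ _)).
  rewrite laplacian_add_spike.
  case: (interior_add_spike xi) => [xi'|->].
    rewrite hf // (_ : x == _ = false) ?mulr0 ?mul0r ?subr0 //.
    by apply/eqP => e; move: xi'; rewrite e (negPf (bdry_not_interior _ _)).
  by rewrite Lf tE fB !eqxx /=; ring.
- by move=> i; rewrite /= ; case: eqP => [->//|/eqP ik] /=; rewrite fB (negPf ik) mulr0 subr0.
- move=> i; rewrite laplacian_add_spike.
  move: (L) t Lf tE d0 fB => {}L t Lf tE d0 fB.
  have -> : \sum_j (L - (c + L k k)^-1 *: (\matrix_(i0, j0) (L i0 k * L k j0))) i j * phi j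
      = \sum_j L i j * phi j - t * L i k.
    under eq_bigr do rewrite !mxE mulrBl.
    rewrite sumrB; congr (_ - _).
    transitivity ((c + L k k)^-1 * L i k * \sum_j L k j * phi j).
      by rewrite mulr_sumr; apply: eq_bigr => j _; ring.
    by rewrite tE; field.
  rewrite /=; case: (i =P k) => [->|ik].
    by rewrite fB eqxx tE /=; ring.
  by rewrite Lf (inj_eq inj) (negPf (introN eqP ik)) mulr0 mul0r subr0.
Qed.

Definition empty_network : network R n :=
  @Network R n 'I_n.+1 'I_0 (fun e => match notF (ltn_ord e) with end) (fun=> 0) id.

Lemma electrical_empty : electrical empty_network.
Proof. by split=> [//|[]//|x]; exists x; exact: connect0. Qed.

Lemma interior_empty x : x \notin interior_vert empty_network.
Proof. by rewrite inE negbK; apply/codomP; exists x. Qed.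

Lemma response_empty : response empty_network = 0.
Proof.
apply: (response_uniq electrical_empty) => phi; exists phi; split=> //.
  by move=> x; rewrite (negPf (interior_empty x)).
move=> k; rewrite /laplacian big_ord0 big1 // => j _.
by rewrite mxE mul0r.
Qed.

End Electrical.

Lemma pair_continuous (R : realType) (T : topologicalType) (F G : T -> R) z :
  {for z, continuous F} -> {for z, continuous G} ->
  {for z, continuous (fun x => (F x, G x))}.
Proof. by move=> hF hG; exact: (cvg_pair hF hG). Qed.

(** * Pushing a dent into the disk *)

Section Dent.
Variables (R : realType) (q : R * R) (lvl : R).
Hypotheses (q1 : q.1 ^+ 2 + q.2 ^+ 2 = 1) (lvl0 : 0 <= lvl) (lvl1 : lvl < 1).
Implicit Types (z : R * R) (c x : R).

Definition dotp z w : R := z.1 * w.1 + z.2 * w.2.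
Definition sqnorm z : R := z.1 ^+ 2 + z.2 ^+ 2.

Definition excess x : R := Num.max 0 (x - lvl).

(** The cap lvl < <z, q> of the disk is compressed towards its chord, in the direction q. *)
Definition dent c z : R * R :=
  (z.1 - c * excess (dotp z q) * q.1, z.2 - c * excess (dotp z q) * q.2).

Lemma excessE x : lvl <= x -> excess x = x - lvl.
Proof. by move=> h; rewrite /excess max_r // subr_ge0. Qed.

Lemma excess0 x : x <= lvl -> excess x = 0.
Proof. by move=> h; rewrite /excess max_l // subr_le0. Qed.

Lemma dotp_dent c z : dotp (dent c z) q = dotp z q - c * excess (dotp z q).
Proof.
rewrite {1}/dotp /=; set m := c * _.
have -> : (z.1 - m * q.1) * q.1 + (z.2 - m * q.2) * q.2
  = dotp z q - m * (q.1 ^+ 2 + q.2 ^+ 2) by rewrite /dotp; ring.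
by rewrite q1 mulr1.
Qed.

Lemma sqnorm_dent c z : sqnorm (dent c z) =
  sqnorm z - c * excess (dotp z q) * (2 * dotp z q - c * excess (dotp z q)).
Proof.
rewrite {1}/sqnorm /=; set m := c * _.
have -> : (z.1 - m * q.1) ^+ 2 + (z.2 - m * q.2) ^+ 2
  = sqnorm z - m * (2 * dotp z q - m * (q.1 ^+ 2 + q.2 ^+ 2)) by rewrite /sqnorm /dotp; ring.
by rewrite q1 mulr1.
Qed.

Lemma dent_incr c x y : 0 <= c < 1 -> x < y -> x - c * excess x < y - c * excess y.
Proof.
move=> /andP[c0 c1] xy.
case: (leP x lvl) => hx; case: (leP y lvl) => hy.
- by rewrite !excess0 // !mulr0 !subr0.
- rewrite (excess0 hx) (excessE (ltW hy)); nra.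
- lra.
- rewrite (excessE (ltW hx)) (excessE (ltW hy)); nra.
Qed.

Lemma dent_inj c : 0 <= c < 1 -> injective (dent c).
Proof.
move=> c01 z w e; have := congr1 (dotp^~ q) e; rewrite !dotp_dent.
have dzw : dotp z q = dotp w q -> z = w.
  move=> d; move: e; rewrite /dent d => -[/addIr e1 /addIr e2].
  by rewrite [z]surjective_pairing e1 e2 -surjective_pairing.
have [lt|lt|/dzw//] := ltgtP (dotp z q) (dotp w q); have := dent_incr c01 lt.
  by move=> + e'; rewrite e' ltxx.
by move=> + e'; rewrite e' ltxx.
Qed.

Lemma sqnorm_dent_le c z : 0 <= c < 1 -> sqnorm (dent c z) <= sqnorm z.
Proof.
move=> /andP[c0 c1]; rewrite sqnorm_dent lerBlDr lerDl.
case: (leP (dotp z q) lvl) => h; first by rewrite (excess0 h) mulr0 mul0r.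
rewrite (excessE (ltW h)); move: (dotp z q) h => x h.
have := lvl0; have : 0 <= (1 - c) * (x - lvl) by apply: mulr_ge0; lra.
by move=> ? ?; apply: mulr_ge0; [apply: mulr_ge0|]; lra.
Qed.

Lemma dent_id c z : dotp z q <= lvl -> dent c z = z.
Proof.
by move=> h; rewrite /dent (excess0 h) mulr0 !mul0r !subr0 -surjective_pairing.
Qed.

Lemma dent0 z : dent 0 z = z.
Proof. by rewrite /dent !mul0r !subr0 -surjective_pairing. Qed.

Lemma sqnorm_dent_lt c z : 0 < c < 1 -> sqnorm z <= 1 -> lvl < dotp z q -> sqnorm (dent c z) < 1.
Proof.
move=> /andP[c0 c1] z1 h; rewrite sqnorm_dent (excessE (ltW h)).
move: (dotp z q) h => x h; have : 0 < c * (x - lvl) by apply: mulr_gt0; lra.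
have : 0 < 2 * x - c * (x - lvl).
  have := lvl0; have : 0 <= (1 - c) * (x - lvl) by apply: mulr_ge0; lra.
  lra.
set a := c * _ => b0 a0; have := mulr_gt0 a0 b0; lra.
Qed.

(** A point of the circle dented less deeply lies outside of the more deeply dented disk: going back
    along q would lead out of the disk. *)
Lemma dent_neq c c' z w : 0 <= c' -> c' < c -> c < 1 -> sqnorm z = 1 -> sqnorm w <= 1 ->
  lvl < dotp z q -> dent c' z <> dent c w.
Proof.
move=> c'0 c'c c1 z1 w1 hz e.
pose b := c * excess (dotp w q) - c' * excess (dotp z q).
have e1 : w.1 = z.1 + b * q.1.
  by have := congr1 fst e; rewrite /dent /= /b => e1; lra.
have e2 : w.2 = z.2 + b * q.2.
  by have := congr1 snd e; rewrite /dent /= /b => e2; lra.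
have dw : dotp w q = dotp z q + b.
  by rewrite /dotp e1 e2 -[b in RHS]mulr1 -q1; ring.
have nw : sqnorm w = 1 + 2 * b * dotp z q + b ^+ 2.
  transitivity (sqnorm z + 2 * b * dotp z q + b ^+ 2 * (q.1 ^+ 2 + q.2 ^+ 2)).
    by rewrite /sqnorm /dotp e1 e2; ring.
  by rewrite q1 z1 mulr1.
have b0 : 0 < b.
  rewrite ltNge; apply/negP => b0.
  have wz : dotp w q <= dotp z q by lra.
  have := congr1 (dotp^~ q) e; rewrite !dotp_dent => e3.
  have c01 : 0 <= c < 1 by lra.
  have : dotp w q - c * excess (dotp w q) <= dotp z q - c * excess (dotp z q).
    move: wz; rewrite le_eqVlt => /orP[/eqP->//|/(dent_incr c01)/ltW//].
  rewrite -e3 (excessE (ltW hz)); nra.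
have d0 : 0 < dotp z q := le_lt_trans lvl0 hz.
move: w1; rewrite nw; have := mulr_gt0 b0 d0; have := mulr_gt0 b0 b0; lra.
Qed.

Lemma dent_continuous c : continuous (dent c).
Proof.
have c1 : continuous (fun z : R * R => z.1 : R) by move=> z; exact: cvg_fst.
have c2 : continuous (fun z : R * R => z.2 : R) by move=> z; exact: cvg_snd.
have ce : continuous (fun z : R * R => c * excess (dotp z q) : R).
  move=> z; apply: cvgM; first exact: cvg_cst.
  apply: (@continuous_max R _ (fun=> 0) (fun z => dotp z q - lvl)); first exact: cvg_cst.
  apply: cvgB; last exact: cvg_cst.
  by apply: cvgD; (apply: cvgM; [|exact: cvg_cst]); [exact: c1|exact: c2].
move=> z; change {for z, continuous (fun z =>
  (z.1 - c * excess (dotp z q) * q.1, z.2 - c * excess (dotp z q) * q.2))}.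
apply: pair_continuous.
  by apply: cvgB; [exact: c1|apply: cvgM; [exact: ce|exact: cvg_cst]].
by apply: cvgB; [exact: c2|apply: cvgM; [exact: ce|exact: cvg_cst]].
Qed.

End Dent.

(** * Drawing spikes and edges *)

Section Planarity.
Variables (R : realType) (n : nat).
Implicit Types (N : network R n) (k l : 'I_n.+1) (c : R).

Definition gap : R := n.+1%:R^-1.
Definition angle k : R := k%:R / n.+1%:R.
Definition cis (x : R) : R * R := (cos x, sin x).

Lemma sqnorm_cis x : sqnorm (cis x) = 1.
Proof. exact: cos2Dsin2. Qed.

Lemma dotp_cis x y : dotp (cis x) (cis y) = cos `|x - y|.
Proof. by rewrite cos_norm cosB. Qed.

Lemma angle_ge0 k : 0 <= angle k.
Proof. by rewrite divr_ge0. Qed.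

Lemma angle_lt1 k : angle k < 1.
Proof. by rewrite ltr_pdivrMr // mul1r ltr_nat. Qed.

Lemma angleS k l : l = k.+1 :> nat -> angle l = angle k + gap.
Proof. by move=> kl; rewrite /angle /gap kl -[k.+1%:R]natr1 mulrDl mul1r. Qed.

Lemma angle_gap k l : (k < l)%N -> angle k + gap <= angle l.
Proof.
move=> kl; rewrite /angle /gap (_ : _ + _ = k.+1%:R / n.+1%:R); last first.
  by rewrite -[k.+1%:R]natr1 mulrDl mul1r.
by rewrite ler_pM2r ?invr_gt0 // ler_nat.
Qed.

Lemma gap_gt0 : 0 < gap.
Proof. by rewrite invr_gt0. Qed.

Lemma gap_le1 : gap <= 1.
Proof. by rewrite invf_le1 // ler1n. Qed.

Lemma angle_inj : injective angle.
Proof.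
move=> j k e; apply: val_inj => /=; have g := gap_gt0.
by case: (ltngtP j k) => [/angle_gap|/angle_gap|//]; rewrite e => ?; exfalso; lra.
Qed.

Lemma pi_gt1 : 1 < pi :> R.
Proof. by have := pi_ge2 R; lra. Qed.

Lemma cos_lt (x y : R) : 0 <= x -> x < y -> y <= 1 -> cos y < cos x.
Proof.
by move=> x0 xy y1; have p := pi_gt1; rewrite ltr_cos // in_itv /=; lra.
Qed.

Lemma cos_le (x y : R) : 0 <= x -> x <= y -> y <= 1 -> cos y <= cos x.
Proof.
by move=> x0; rewrite le_eqVlt => /orP[/eqP->//|xy y1]; apply/ltW/cos_lt.
Qed.

Lemma cos_ge0_1 (x : R) : 0 <= x <= 1 -> 0 <= cos x.
Proof. by move=> h; apply: cos_ge0_pihalf; have := pi_ge2 R; lra. Qed.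

Lemma cos_lt1 (x : R) : 0 < x -> x <= 1 -> cos x < 1.
Proof. by move=> x0 x1; rewrite -(@cos0 R); apply: cos_lt. Qed.

(** Angles stay in [0, 1], where the cosine is injective. *)
Lemma cis_inj (x y : R) : 0 <= x <= 1 -> 0 <= y <= 1 -> cis x = cis y -> x = y.
Proof.
move=> hx hy [e _]; have p := pi_gt1; apply: cos_inj e; rewrite in_itv /=; lra.
Qed.

Lemma angle_norm k l : `|angle k - angle l| <= 1.
Proof.
have := angle_ge0 k; have := angle_ge0 l; have := angle_lt1 k; have := angle_lt1 l.
by move=> *; rewrite ler_norml; lra.
Qed.

(** A planar drawing with the boundary vertices at the fixed angles k / (n + 1); all gaps
    being small, each cap between neighbouring vertices lies in a half disk. *)
Definition embedded N (pos : vert N -> R * R) (arc : edge N -> R -> R * R) : Prop :=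
  [/\ forall k, pos (bdry N k) = cis (angle k),
      injective pos /\ (forall x, x \in interior_vert N -> open_disk (pos x)),
      forall e, [/\ {within `[0, 1], continuous (arc e)},
                    arc e 0 = pos (ends e).1 & arc e 1 = pos (ends e).2],
      forall e (t : R), 0 < t < 1 ->
        open_disk (arc e t) /\ (forall x, arc e t <> pos x)
    & forall e f (s t : R), 0 < s < 1 -> 0 < t < 1 ->
        arc e s = arc f t -> e = f /\ s = t].

Definition drawable N : Prop := exists pos arc, @embedded N pos arc.

Lemma drawable_planar N : drawable N -> planar N.
Proof.
case=> pos [arc [E1 E2 E3 E4 E5]]; exists pos, arc, angle; split=> //; split=> //.
  by move=> j k /angle_gap; have := gap_gt0; lra.
have := angle_lt1 (@ord_max n); have := angle_ge0 (@ord0 n); have := pi_gt1; lra.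
Qed.

Lemma drawable_empty : drawable (empty_network R n).
Proof.
exists (fun k => cis (angle k)), (fun e : 'I_0 => match notF (ltn_ord e) with end).
split=> //; try by case.
split=> [j k|x]; last by rewrite (negPf (interior_empty x)).
have b i : 0 <= angle i <= 1 by rewrite angle_ge0 ltW // angle_lt1.
by move/(cis_inj (b j) (b k))/angle_inj.
Qed.

Lemma embedded_sqnorm N pos arc : @embedded N pos arc -> forall x, sqnorm (pos x) <= 1.
Proof.
case=> E1 [_ E2] _ _ _ x; case: (boolP (x \in interior_vert N)) => [/E2/ltW//|].
by rewrite inE negbK => /codomP[k ->]; rewrite E1 sqnorm_cis.
Qed.

(** The old picture is dented at the boundary vertex k, on a cap too small to contain any other
    boundary vertex; the spike joins the moved vertex k to its old place. *)
Lemma drawable_add_spike N k c : electrical N -> drawable N -> drawable (add_spike k c N).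
Proof.
move=> [inj _ _] [pos [arc E]]; have nle := embedded_sqnorm E; have [E1 [E2 E2'] E3 E4 E5] := E.
pose q := cis (angle k); pose lvl : R := cos gap.
have [g0 g1] := (gap_gt0, gap_le1).
have q1 : q.1 ^+ 2 + q.2 ^+ 2 = 1 := sqnorm_cis _.
have lvl0 : 0 <= lvl by apply: cos_ge0_1; rewrite ltW.
have lvl1 : lvl < 1 by apply: cos_lt1.
have qq : lvl < dotp q q by rewrite /dotp -!expr2 q1.
have h2 : 0 <= (2^-1 : R) < 1 by lra.
have h2' : 0 < (2^-1 : R) < 1 by lra.
pose D := dent q lvl (2^-1).
have Dinj : injective D by apply: dent_inj.
have Dle z : sqnorm (D z) <= sqnorm z by apply: sqnorm_dent_le.
pose pos' (x : option (vert N)) := if x is Some y then D (pos y) else q.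
pose arc' (e : option (edge N)) (t : R) :=
  if e is Some e' then D (arc e' t) else dent q lvl (t / 2) q.
have anle e t : 0 < t < 1 -> sqnorm (arc e t) <= 1 by move=> /(E4 e)[/ltW].
have th (t : R) : 0 < t < 1 -> 0 < t / 2 < 1 /\ t / 2 < 2^-1 by lra.
have new_open t : 0 < t < 1 -> sqnorm (dent q lvl (t / 2) q) < 1.
  by move=> /th[t01 _]; apply: sqnorm_dent_lt => //; rewrite /sqnorm q1.
have new_out t w : 0 <= t < 1 -> sqnorm w <= 1 -> dent q lvl (t / 2) q <> D w.
  by move=> t01 w1; apply: dent_neq => //; lra.
exists pos', arc'; split.
- move=> j; rewrite /= ; case: (j =P k) => [->//|jk] /=.
  rewrite /D E1 dent_id // dotp_cis.
  have njk : j <> k :> nat by move=> e; apply: jk; apply: val_inj.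
  apply: cos_le; [exact: ltW| |exact: angle_norm].
  by rewrite ler_normr; case: (ltngtP j k) => [/angle_gap|/angle_gap|//]; lra.
- split.
    have qD y : q <> D (pos y).
      have := @new_out 0 (pos y); rewrite mul0r dent0 => H; apply: H => //; lra.
    by case=> [x|] [y|] //= => [/Dinj/E2->//|/esym/qD|/qD].
  case=> [x|]; last by rewrite (negPf (None_not_interior _ _ _)).
  case/interior_add_spike => [/E2' xi|->] /=.
    by apply: le_lt_trans (Dle _) xi.
  by rewrite E1; apply: sqnorm_dent_lt => //; rewrite sqnorm_cis.
- case=> [e|] /=.
    have [ec e0 e1] := E3 e; split; rewrite ?e0 ?e1 //.
    by move=> x; apply: continuous_comp; [exact: ec|exact: dent_continuous].
  split; rewrite ?mul0r ?dent0 // ?mul1r ?E1 //.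
  have cq (a b : R) : continuous (fun t : R => a - t / 2 * excess lvl (dotp q q) * b).
    move=> t; apply: cvgB; first exact: cvg_cst.
    by apply: cvgM; [apply: cvgM; [apply: cvgM; [exact: cvg_id|]|]|]; exact: cvg_cst.
  apply: continuous_subspaceT => t.
  exact: (pair_continuous (cq q.1 q.1 t) (cq q.2 q.2 t)).
- case=> [e|] t t01 /=; last first.
    split=> [|[x|] /=]; [exact: new_open|apply: new_out => //; lra|].
    by move=> e; have := new_open t t01; rewrite e /sqnorm q1 ltxx.
  have [oa a] := E4 e t t01; have o' : open_disk (D (arc e t)) by apply: le_lt_trans (Dle _) oa.
  split=> // -[x|] /=; first by move/Dinj; exact: a.
  by move=> e'; move: o'; rewrite e' /open_disk /= q1 ltxx.
- case=> [e|] [f|] s t s01 t01 /=.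
  + by move/Dinj/(E5 _ _ _ _ s01 t01) => [-> ->].
  + by move/esym => /new_out[]; [lra|exact: anle].
  + by move=> /new_out[]; [lra|exact: anle].
  + move=> e; split=> //; have := congr1 (fun z => dotp z q) e.
    rewrite !dotp_dent // (excessE (ltW qq)).
    have : dotp q q - lvl != 0 by rewrite subr_eq0 gt_eqF.
    by move=> nz /addrI/oppr_inj/(mulIf nz) e2; lra.
Qed.

(** The old picture is dented along the arc from k to k + 1, with the chord of these two vertices
    as fixed line; the new edge is that arc, dented half as deep. *)
Lemma drawable_add_edge N k l c : l = k.+1 :> nat -> drawable N -> drawable (add_edge k l c N).
Proof.
move=> kl [pos [arc E]]; have nle := embedded_sqnorm E; have [E1 [E2 E2'] E3 E4 E5] := E.
pose mu := (angle k + angle l) / 2; pose hg : R := gap / 2.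
pose q := cis mu; pose lvl : R := cos hg.
have [g0 g1] := (gap_gt0, gap_le1).
have lk := angleS kl.
have hg0 : 0 < hg by rewrite /hg; lra.
have hg1 : hg <= 1 by rewrite /hg; lra.
have q1 : q.1 ^+ 2 + q.2 ^+ 2 = 1 := sqnorm_cis _.
have lvl0 : 0 <= lvl by apply: cos_ge0_1; rewrite ltW.
have lvl1 : lvl < 1 by apply: cos_lt1.
have [tk0 tk1 tl1] := And3 (angle_ge0 k) (angle_lt1 k) (angle_lt1 l).
have Ddot j : dotp (cis (angle j)) q <= lvl.
  have := angle_ge0 j; have := angle_lt1 j => j1 j0.
  rewrite dotp_cis; apply: cos_le; [exact: ltW| |by rewrite ler_norml /mu; lra].
  rewrite ler_normr /mu /hg; case: (ltngtP j k) => [/angle_gap|kj|/val_inj->]; [lra| |lra].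
  case: (ltngtP l j) => [/angle_gap|jl|/val_inj<-]; [lra| |lra].
  by move: jl; rewrite kl ltnS leqNgt kj.
have h2 : 0 <= (2^-1 : R) < 1 by lra.
have h4 : 0 <= (4^-1 : R) < 1 by lra.
have h4' : 0 < (4^-1 : R) < 1 by lra.
have h42 : (4^-1 < 2^-1 :> R) by lra.
pose D := dent q lvl (2^-1).
have Dinj : injective D by apply: dent_inj.
have Dle z : sqnorm (D z) <= sqnorm z by apply: sqnorm_dent_le.
have Dp j : D (pos (bdry N j)) = cis (angle j) by rewrite E1 /D dent_id.
pose ang (t : R) := angle k + t * gap.
pose new (t : R) := dent q lvl (4^-1) (cis (ang t)).
pose arc' (e : option (edge N)) (t : R) :=
  if e is Some e' then D (arc e' t) else new t.
have anle e t : 0 < t < 1 -> sqnorm (arc e t) <= 1 by move=> /(E4 e)[/ltW].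
have ang01 t : 0 < t < 1 -> angle k < ang t < angle l.
  by move=> t01; rewrite lk /ang; nra.
have new_dot t : 0 < t < 1 -> lvl < dotp (cis (ang t)) q.
  move=> /ang01 a01; rewrite dotp_cis; apply: cos_lt => //.
  by rewrite ltr_norml /mu /hg; lra.
have new_open t : 0 < t < 1 -> sqnorm (new t) < 1.
  by move=> t01; apply: sqnorm_dent_lt => //; [rewrite sqnorm_cis|exact: new_dot].
have new_out t w : 0 < t < 1 -> sqnorm w <= 1 -> new t <> D w.
  move=> t01 w1; apply: (dent_neq q1 lvl0 _ h42) => //; try lra.
    exact: sqnorm_cis.
  exact: new_dot.
exists (fun x => D (pos x)), arc'; split.
- by move=> j; rewrite /= Dp.
- split=> [x y /Dinj/E2//|x xi]; apply: le_lt_trans (Dle _) _; exact: E2'.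
- case=> [e|] /=.
    have [ec e0 e1] := E3 e; split; rewrite ?e0 ?e1 //.
    by move=> x; apply: continuous_comp; [exact: ec|exact: dent_continuous].
  split; rewrite ?Dp /new /ang ?mul0r ?addr0 ?mul1r -?lk ?dent_id //.
  apply: continuous_subspaceT => t.
  change {for t, continuous (dent q lvl (4^-1) \o (fun t => cis (ang t)))}.
  apply: continuous_comp; last exact: dent_continuous.
  have ca : continuous ang.
    by move=> x; apply: cvgD; [exact: cvg_cst|apply: cvgM; [exact: cvg_id|exact: cvg_cst]].
  apply: pair_continuous; (apply: continuous_comp; first exact: ca);
  [exact: continuous_cos|exact: continuous_sin].
- case=> [e|] t t01 /=; last first.
    by split=> [|x]; [exact: new_open|exact: new_out].
  have [oa a] := E4 e t t01; split=> [|x]; first by apply: le_lt_trans (Dle _) oa.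
  by move/Dinj; exact: a.
- case=> [e|] [f|] s t s01 t01 /=.
  + by move/Dinj/(E5 _ _ _ _ s01 t01) => [-> ->].
  + by move/esym => /new_out[]; [lra|exact: anle].
  + by move=> /new_out[]; [lra|exact: anle].
  + move/(dent_inj q1 h4) => e; split=> //.
    have := ang01 s s01; have := ang01 t t01 => b1 b2.
    have /addrI/mulIf e2 : ang s = ang t by apply: cis_inj e; lra.
    by apply: e2; rewrite gt_eqF.
Qed.

End Planarity.

(** * Response matrices as subspaces *)

Section Action.
Variables (R : realType) (n : nat).
Local Notation M2 := 'M[R]_(n + n).
Implicit Types (M : 'M[R]_n) (N : network R n) (g : M2) (k : 'I_n.+1).
Local Notation va k := (veca R n k).
Local Notation vb k := (vecb R n k).

(** The signs are alternating so that row k is, up to sign, the vector a_k of the group. *)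
Definition incidence : 'M[R]_(n.+1, n) := \matrix_(i, j) ((-1) ^+ i * va i j 0).

Definition of_form M : 'M[R]_n.+1 := incidence *m M *m incidence^T.

(** Alternating partial sums invert the incidence matrix on the left. *)
Lemma of_form_inj : injective of_form.
Proof.
pose T : 'M[R]_(n, n.+1) := \matrix_(i, j) ((-1) ^+ i * (j <= i)%N%:R).
have TD : T *m incidence = 1%:M.
  apply/matrixP => i j; rewrite !mxE.
  (* the only two nonzero terms of the alternating sum *)
  pose j1 : 'I_n.+1 := widen_ord (leqnSn n) j; pose j2 : 'I_n.+1 := lift ord0 j.
  rewrite (bigD1 j1) //= (bigD1 j2) /=; last first.
    by apply/eqP => /(congr1 (@nat_of_ord _)); rewrite lift0 /=; lia.
  rewrite big1 ?addr0 => [|l /andP[l1 l2]]; last first.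
    rewrite !mxE.
    have -> : (j == l :> nat) = false by apply: contraNF l1 => /eqP e; apply/eqP/val_inj.
    have -> : (j.+1 == l :> nat) = false.
      by apply: contraNF l2 => /eqP e; apply/eqP/val_inj; rewrite -lift0 in e.
    by rewrite addr0 !mulr0.
  have e1 : j1 = j :> nat by [].
  have e2 : j2 = j.+1 :> nat by rewrite lift0.
  rewrite !mxE e1 e2 !eqxx (_ : (j.+1 == j) = false); last lia.
  rewrite (_ : (j == j.+1 :> nat) = false); last lia.
  rewrite addr0 add0r !mulr1.
  case: (ltngtP j i) => [ji|ij|e]; last first.
  - by rewrite (val_inj e) eqxx mulr1 mulr0 mul0r addr0 -exprD addnn -muln2 exprM sqrr_sign.
  - by rewrite !mulr0 !mul0r addr0 -val_eqE /= (_ : (i == j :> nat) = false) //; lia.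
  - by rewrite exprS mulr1 mulN1r mulrN subrr -val_eqE /= (_ : (i == j :> nat) = false) //; lia.
move=> M M' /(congr1 (fun X => T *m X *m T^T)); rewrite /of_form.
by rewrite !mulmxA TD !mul1mx -!mulmxA -trmx_mul TD trmx1 !mulmx1.
Qed.

Lemma of_form0 : of_form 0 = 0.
Proof. by rewrite /of_form mulmx0 mul0mx. Qed.

Lemma of_formE M i j :
  of_form M i j = (-1) ^+ i * (-1) ^+ j * ((va i)^T *m M *m va j) 0 0.
Proof.
have r k l : incidence k l = (-1) ^+ k * (va k)^T 0 l by rewrite !mxE.
have -> : of_form M i j = \sum_l (\sum_m incidence i m * M m l) * incidence j l.
  by rewrite !mxE; apply: eq_bigr => l _; rewrite !mxE.
rewrite [in RHS]mxE mulr_sumr; apply: eq_bigr => l _.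
rewrite [in RHS]mxE !mulr_suml mulr_sumr; apply: eq_bigr => m _.
by rewrite !r !mxE; ring.
Qed.

Lemma of_form_rank1 M k :
  \matrix_(i, j) (of_form M i k * of_form M k j) =
  of_form (M *m (va k *m (va k)^T) *m M).
Proof.
apply/matrixP => i j; rewrite mxE !of_formE.
have -> : (va i)^T *m (M *m (va k *m (va k)^T) *m M) *m va j =
    ((va i)^T *m M *m va k) *m ((va k)^T *m M *m va j) by rewrite !mulmxA.
rewrite [in RHS]mxE big_ord1.
set x := (_ *m _) 0 0; set y := (_ *m _) 0 0.
have e : (-1) ^+ k * (-1) ^+ k = 1 :> R by rewrite -expr2 sqrr_sign.
move: ((-1) ^+ k) ((-1) ^+ i) ((-1) ^+ j) e => u v w e.
by transitivity (u * u * (v * w * (x * y))); [ring | rewrite e mul1r].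
Qed.

Lemma of_form_diag M k : of_form M k k = ((va k)^T *m M *m va k) 0 0.
Proof. by rewrite of_formE -expr2 sqrr_sign mul1r. Qed.

(** The vector eps_k - eps_(k+1) is, up to sign, the image of b_k. *)
Lemma of_form_edge k (l : 'I_n.+1) (j : nat) : (j < n)%N -> k = j :> nat -> l = j.+1 :> nat ->
  \matrix_(p, q) (((p == k)%:R - (p == l)%:R) * ((q == k)%:R - (q == l)%:R)) =
  of_form (vb j *m (vb j)^T).
Proof.
move=> jn kj lj.
have E p : ((va p)^T *m vb j) 0 0 = (-1) ^+ p * ((-1) ^+ j * ((p == k)%:R - (p == l)%:R)).
  have -> : (p == k) = (j == p :> nat) by rewrite eq_sym -kj.
  have -> : (p == l) = (j.+1 == p :> nat) by rewrite eq_sym -lj.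
  rewrite veca_vecb // mxE eqxx mulr1n.
  case: (j =P p) => [<-|_]; last case: (j.+1 =P p) => [<-|_].
  - rewrite (_ : (j.+1 == j) = false); last lia.
    by rewrite addr0 subr0 mulr1 -expr2 sqrr_sign.
  - by rewrite add0r sub0r mulrN1 exprS mulN1r mulrNN -expr2 sqrr_sign.
  - by rewrite addr0 subr0 !mulr0.
apply/matrixP => p q; rewrite mxE of_formE.
have -> : (va p)^T *m (vb j *m (vb j)^T) *m va q =
    ((va p)^T *m vb j) *m ((va q)^T *m vb j)^T by rewrite trmx_mul trmxK !mulmxA.
rewrite mxE big_ord1 [_^T _ _]mxE !E.
set x := _ - _; set y := _ - _.
have e (i : nat) : (-1) ^+ i * (-1) ^+ i = 1 :> R by rewrite -expr2 sqrr_sign.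
move: ((-1) ^+ p) (e p) ((-1) ^+ q) (e q) ((-1) ^+ j) (e j) => u eu v ev w ew.
transitivity (u * u * (v * v) * (w * w) * (x * y)); last by ring.
by rewrite eu ev ew !mul1r.
Qed.

Lemma of_formD M M' : of_form (M + M') = of_form M + of_form M'.
Proof. by rewrite /of_form mulmxDr mulmxDl. Qed.

Lemma of_formB M M' : of_form (M - M') = of_form M - of_form M'.
Proof. by rewrite /of_form mulmxBr mulmxBl. Qed.

Lemma of_formZ (a : R) M : of_form (a *: M) = a *: of_form M.
Proof. by rewrite /of_form -scalemxAr -scalemxAl. Qed.

Definition graph_mx M : 'M[R]_(n + n, n) := col_mx 1%:M M.

Lemma ugen_graph_even (i : nat) (a : R) M : ~~ odd i ->
  @ugen R n i a *m graph_mx M = col_mx (1%:M + a *: (va i./2 *m (va i./2)^T *m M)) M.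
Proof.
move=> /negPf oi; rewrite /ugen mulmxDl mul1mx -scalemxAl /egen oi mul_block_col.
by rewrite !mul0mx add0r addr0 scale_col_mx scaler0 add_col_mx addr0.
Qed.

Lemma ugen_graph_odd (i : nat) (a : R) M : odd i ->
  @ugen R n i a *m graph_mx M = graph_mx (M + a *: (vb i./2 *m (vb i./2)^T)).
Proof.
move=> oi; rewrite /ugen mulmxDl mul1mx -scalemxAl /egen oi mul_block_col.
by rewrite !mul0mx addr0 mulmx1 addr0 scale_col_mx scaler0 add_col_mx addr0.
Qed.

(** An edge adds a b b^T to M.  A spike subtracts s M A M with A = a_k a_k^T, which is the
    fractional linear action of u_i because A M A = L_kk A and s = (1/a + L_kk)^-1. *)
Lemma op_v_graph (i : 'I_(n.*2)) (a : R) N M : 0 <= a -> electrical N ->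
  response N = of_form M ->
  exists M' P, [/\ P \in unitmx, response (op_v i a N) = of_form M' &
    gen_u i a *m graph_mx M = graph_mx M' *m P].
Proof.
move=> a0 eN eM; rewrite gen_uE /op_v.
case: (a =P 0) => [->|/eqP an0].
  by exists M, 1%:M; rewrite unitmx1 ugen0 mul1mx mulmx1.
have {an0}a0 : 0 < a by rewrite lt0r an0.
have i2 := ltn_ord i; have j2 : (i./2 < n)%N by lia.
case: ifP => oi.
  exists (M + a *: (vb i./2 *m (vb i./2)^T)), 1%:M; rewrite unitmx1 mulmx1 ugen_graph_odd //.
  split=> //; rewrite response_add_edge // eM of_formD of_formZ (@of_form_edge _ _ i./2) //.
    by rewrite inordK //; lia.
  by rewrite inordK //; lia.
have k2 : (inord i./2 : 'I_n.+1) = i./2 :> nat by rewrite inordK //; lia.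
set k := inord _ in k2 *; rewrite response_add_spike ?invr_gt0 // eM of_form_rank1.
have d0 : 0 <= of_form M k k by rewrite -eM; exact: response_ge0.
set d := of_form M k k in d0 *; pose s := (a^-1 + d)^-1.
pose A := va k *m (va k)^T.
have AMA : A *m M *m A = d *: A.
  rewrite /A !mulmxA -[X in X *m _]mulmxA -[X in X *m _]mulmxA.
  rewrite [(va k)^T *m _]mulmxA /d of_form_diag.
  by rewrite [X in _ *m X *m _]mx11_scalar mul_mx_scalar -scalemxAl.
have sE : a - s - s * a * d = 0.
  by rewrite /s; field; rewrite !gt_eqF // ltr_pwDl // mulr_ge0 // ltW.
exists (M - s *: (M *m A *m M)), (1%:M + a *: (A *m M)); split.
- suff : (1%:M + a *: (A *m M)) *m (1%:M - s *: (A *m M)) = 1%:M by case/mulmx1_unit.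
  rewrite mulmxBr mulmx1 mulmxDl mul1mx -scalemxAl -scalemxAr mulmxA AMA -scalemxAl !scalerA.
  set X := A *m M; rewrite -[RHS]addr0 -(scale0r X) -sE.
  by apply/matrixP => p q; rewrite !mxE; ring.
- by rewrite of_formB of_formZ.
- rewrite ugen_graph_even ?oi // -k2 -/A /graph_mx mul_col_mx mul1mx; congr col_mx.
  have MAMAM : M *m A *m M *m A *m M = d *: (M *m A *m M).
    by have := congr1 (fun Z => M *m Z *m M) AMA; rewrite /= -scalemxAr -scalemxAl !mulmxA.
  rewrite mulmxDr mulmx1 mulmxBl -!scalemxAr -!scalemxAl !mulmxA.
  move: MAMAM; rewrite /A !mulmxA => ->; rewrite !scalerA.
  set X := M *m va k *m (va k)^T *m M; rewrite -[LHS]addr0 -(scale0r X) -sE.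
  by apply/matrixP => p q; rewrite !mxE; ring.
Qed.

(** The action on response matrices is the linear action on graphs; in particular it is
    well defined. *)
Lemma acts_graph g L L' : acts g L L' -> forall M, L = of_form M ->
  exists M' P, [/\ P \in unitmx, L' = of_form M' & g *m graph_mx M = graph_mx M' *m P].
Proof.
elim=> [i a N a0 eN _ M eM|{}g h L1 L2 L3 _ IH1 _ IH2 M eM].
  exact: op_v_graph.
have [M1 [P1 [u1 e1 f1]]] := IH1 _ eM; have [M2 [P2 [u2 e2 f2]]] := IH2 _ e1.
exists M2, (P2 *m P1); rewrite unitmx_mul u2 u1; split=> //.
by rewrite -mulmxA f1 mulmxA f2 !mulmxA.
Qed.

Lemma graph_mx_inj M M' P P' : graph_mx M *m P = graph_mx M' *m P' -> P \in unitmx ->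
  P = P' /\ M = M'.
Proof.
rewrite /graph_mx !mul_col_mx !mul1mx => /eq_col_mx[<- e] uP; split=> //.
by rewrite -[M](mulmxK uP) e mulmxK.
Qed.

Lemma acts_uniq g L1 L2 : acts g 0 L1 -> acts g 0 L2 -> L1 = L2.
Proof.
have z := esym of_form0.
move=> /acts_graph/(_ 0 z)[M1 [P1 [u1 -> e1]]] /acts_graph/(_ 0 z)[M2 [P2 [u2 -> e2]]].
by rewrite e1 in e2; have [_ ->] := graph_mx_inj e2 u1.
Qed.

Lemma drawable_op_v (i : 'I_(n.*2)) (a : R) N : 0 < a -> electrical N -> drawable N ->
  electrical (op_v i a N) /\ drawable (op_v i a N).
Proof.
move=> a0 eN dN; rewrite /op_v gt_eqF //; have i2 := ltn_ord i; case: ifP => oi.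
  split; first exact: electrical_add_edge.
  by apply: drawable_add_edge => //; rewrite !inordK //; lia.
split; first by apply: electrical_add_spike; rewrite ?invr_gt0.
exact: drawable_add_spike.
Qed.

(** Each operation is applied to a drawable network, so the action can be carried out to the end. *)
Lemma acts_word (x : seq ('I_(n.*2) * R)) : (0 < n)%N -> (forall p, p \in x -> 0 < p.2) ->
  exists N, [/\ electrical N, drawable N & acts (\prod_(p <- x) gen_u p.1 p.2) 0 (response N)].
Proof.
move=> n0; elim: x => [|[i a] x IH] px.
  exists (empty_network R n); split; [exact: electrical_empty|exact: drawable_empty|].
  have i2 : (0 < n.*2)%N by lia.
  have := Defs.acts_gen (Ordinal i2) (lexx 0) (electrical_empty R n)
    (drawable_planar (drawable_empty R n)).
  by rewrite big_nil gen_uE ugen0 /op_v eqxx response_empty.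
have [p|N [eN dN aN]] := IH; first by move=> xp; apply: px; rewrite inE xp orbT.
have a0 : 0 < a by apply: (px (i, a)); rewrite inE eqxx.
have [eN' dN'] := drawable_op_v i a0 eN dN.
exists (op_v i a N); split=> //; rewrite big_cons /=.
by apply: Defs.acts_mul aN _; apply: Defs.acts_gen; [exact: ltW| |exact: drawable_planar].
Qed.

Lemma Theta_graph w g : (0 < n)%N -> cellE R w g ->
  planar_responses R n (Theta g) /\
  exists M P, [/\ P \in unitmx, Theta g = of_form M & g *m base_mx R n = graph_mx M *m P].
Proof.
move=> n0 [x [_ px gE]]; have [N [eN dN aN]] := acts_word n0 px; rewrite -gE in aN.
have aT : acts g 0 (Theta g) by apply: xgetPex; exists (response N).
split; last exact: (acts_graph aT (esym of_form0)).
by exists N; split=> //; [exact: drawable_planar|exact: acts_uniq aT aN].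
Qed.

Lemma Theta_same w w' g g' : (0 < n)%N -> cellE R w g -> cellE R w' g' ->
  Theta g = Theta g' <-> same_span g g'.
Proof.
move=> n0 /(Theta_graph n0)[_ [M [P [uP -> e]]]] /(Theta_graph n0)[_ [M' [P' [uP' -> e']]]].
split=> [/of_form_inj MM|[Q uQ]].
  exists (invmx P *m P'); first by rewrite unitmx_mul unitmx_inv uP.
  by rewrite e e' MM !mulmxA mulmxK.
by rewrite e e' -mulmxA => /esym/graph_mx_inj[|_ -> //]; rewrite unitmx_mul uP.
Qed.

End Action.


Theorem theorem4p5 (R : realType) (n : nat) (hn : (1 <= n)%N) :
  [/\ forall w : 'S_(n.*2.+1),
        set_fun (cellE R w) (planar_responses R n) (@Theta R n),
      forall w : 'S_(n.*2.+1),
        set_inj (cellE R w) (@Theta R n) <-> efficient w,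
      forall w v : 'S_(n.*2.+1), efficient w -> efficient v -> w <> v ->
        (@Theta R n @` cellE R w) `&` (@Theta R n @` cellE R v) = set0
    & forall w : 'S_(n.*2.+1), ~ efficient w ->
        exists! v : 'S_(n.*2.+1), efficient v /\
          @Theta R n @` cellE R w = @Theta R n @` cellE R v].
Proof.
have same_imp (w v : 'S_(n.*2.+1)) g g' :
    cellE R w g -> cellE R v g' -> Theta g = Theta g' -> same_span g g'.
  by move=> E E'; case: (Theta_same hn E E').
have imp_same (w v : 'S_(n.*2.+1)) g g' :
    cellE R w g -> cellE R v g' -> same_span g g' -> Theta g = Theta g'.
  by move=> E E'; case: (Theta_same hn E E').
have meet (w v : 'S_(n.*2.+1)) g g' : efficient w -> efficient v -> cellE R w g -> cellE R v g' ->
    Theta g = Theta g' -> w = v.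
  by move=> ew ev E E' e; apply: (cellE_disjoint ew ev E E'); exact: same_imp E E' e.
split.
- by move=> w g E; case: (Theta_graph hn E).
- move=> w; split=> [inj|ew g g' /set_mem E /set_mem E' e].
    have [//|/(@cellE_noninj R n)[g [g' [E E' s ne]]]] := pselect (efficient w).
    by case: ne; apply: inj; rewrite ?inE //; exact: imp_same E E' s.
  by apply: (cellE_inj ew E E'); exact: same_imp E E' e.
- move=> w v ew ev wv; apply/seteqP; split=> // L [[g E <-] [g' E' e]].
  by case: wv; apply: (meet w v g g').
- move=> w nw; have [g0 /cellE_same_Cell[m0 [g1 [C1 s1]]]] := cellE_nonempty R w.
  have [v [ev hv E1]] := Cell_efficient C1.
  have wv : @Theta R n @` cellE R w = @Theta R n @` cellE R v.
    apply/seteqP; split=> L [g E <-].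
      have [m [g' [C' s']]] := cellE_same_Cell E; rewrite -hv in C'.
      have E' := Cell_cellE ev C'; exists g' => //.
      by apply/esym; exact: imp_same E E' s'.
    have [m C] := cellE_Cell ev E; rewrite hv in C.
    by have [g' E' s'] := Cell_same_cellE C; exists g' => //; exact: imp_same E' E s'.
  exists v; split=> // v' [ev' wv'].
  have : (@Theta R n @` cellE R v') (Theta g1) by rewrite -wv' wv; exists g1.
  by case=> g2 E2 e2; apply/esym; apply: (meet v' v g2 g1).
Qed.
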